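(* For a morphism $f=(A,\mu,\Sigma)\in\mathsf{Gauss}(\mathbb R^m,\mathbb R^n)$ define a concave bifunction $\mathrm{logpdf}_f$ from $\mathbb R^n$ to $\mathbb R^m$ and a convex bifunction $\mathrm{cgf}_f$ from $\mathbb R^m$ to $\mathbb R^n$ by \[ \mathrm{logpdf}_f(y,x) = -\tfrac12\langle z,\Sigma^{-}z\rangle - \{|z\in S|\},\qquad \mathrm{cgf}_f(x,y)=\tfrac12\langle y,\Sigma y\rangle+\langle\mu,y\rangle+\{|x=A^Ty|\}, \] where $z=y-(Ax+\mu)$, $S=\mathrm{im}(\Sigma)$ and $\Sigma^{-}$ denotes any generalized inverse of $\Sigma$. Then the assignments (identity on objects) $f\mapsto \mathrm{logpdf}_f$ and $f\mapsto\mathrm{cgf}_f$ define functors of copy-delete categories \[ \mathrm{logpdf}:\mathsf{Gauss}\to(\mathtt{CvBiFn}^{\mathrm{op}},\bullet),\qquad \mathrm{cgf}:\mathsf{Gauss}\to(\mathtt{CxBiFn},\circ), \] and these are in a duality situation: for every morphism $f$ of $\mathsf{Gauss}$, $(\mathrm{cgf}_f)^*=\mathrm{logpdf}_f$ and $(\mathrm{logpdf}_f)^*=\mathrm{cgf}_f$.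
   Context: Notation: $\overline{\mathbb R}=[-\infty,+\infty]$; $\langle-,-\rangle$ is the standard inner product; $\{|P|\}$ is the convex indicator, equal to $0$ if $P$ holds and $+\infty$ otherwise. A function $h:\mathbb R^n\to\overline{\mathbb R}$ is convex if its epigraph $\{(x,y)\in\mathbb R^{n+1}:y\ge h(x)\}$ is convex, and concave if $-h$ is convex. A convex (concave) bifunction from $\mathbb R^m$ to $\mathbb R^n$ is a jointly convex (concave) function $F:\mathbb R^m\times\mathbb R^n\to\overline{\mathbb R}$. $\mathtt{CxBiFn}$ has objects $\mathbb R^n$ ($n\ge 0$), morphisms $\mathbb R^m\to\mathbb R^n$ the convex bifunctions, identities $\mathrm{id}(x,y)=\{|x=y|\}$, composition $(F\circ G)(x,z)=\inf_y\{G(x,y)+F(y,z)\}$. $\mathtt{CvBiFn}$ has the same objects, concave bifunctions as morphisms, identities $-\{|x=y|\}$, composition $(F\circ G)(x,z)=\sup_y\{G(x,y)+F(y,z)\}$. Addition on $\overline{\mathbb R}$ uses $(+\infty)+(-\infty)=+\infty$ in $\mathtt{CxBiFn}$ and $=-\infty$ in $\mathtt{CvBiFn}$. Both are symmetric strict monoidal with $\mathbb R^m\otimes\mathbb R^n=\mathbb R^{m+n}$, unit $I=\mathbb R^0=\{\mathbf 0\}$, and $(F\otimes G)((x_1,x_2),(y_1,y_2))=F(x_1,y_1)+G(x_2,y_2)$. A copy-delete category is a symmetric monoidal category in which every object $X$ carries a commutative comonoid structure $\mathrm{copy}_X:X\to X\otimes X$, $\mathrm{discard}_X:X\to I$ (compatible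 with the tensor). A functor of copy-delete categories is a symmetric monoidal functor (here strict and identity on objects) preserving copy and discard. Copy-delete structures used: $(\mathtt{CxBiFn},\circ)$ has $\mathrm{copy}:\mathbb R^n\to\mathbb R^n\otimes\mathbb R^n$, $\mathrm{copy}(z,(x,y))=\{|x+y=z|\}$, and $\mathrm{discard}:\mathbb R^n\to I$, $\mathrm{discard}(x,\mathbf 0)=\{|x=0|\}$. $(\mathtt{CvBiFn}^{\mathrm{op}},\bullet)$ has as copy on $\mathbb R^n$ the concave bifunction $\mathbb R^n\otimes\mathbb R^n\to\mathbb R^n$, $((x,y),z)\mapsto-\{|x=y=z|\}$, and as discard the concave bifunction $I\to\mathbb R^n$, $(\mathbf 0,x)\mapsto 0$ (both regarded as morphisms of the opposite category). Adjoints: for a convex bifunction $F$ from $\mathbb R^m$ to $\mathbb R^n$, $F^*$ is the concave bifunction from $\mathbb R^n$ to $\mathbb R^m$ given by $F^*(y^*,x^* )=\inf_{x,y}\{F(x,y)+\langle x^*,x\rangle-\langle y^*,y\rangle\}$. For a concave bifunction $G$ from $\mathbb R^n$ to $\mathbb R^m$, $G^*$ is the convex bifunction from $\mathbb R^m$ to $\mathbb R^n$ given by $G^*(x^*,y^* )=\sup_{y,x}\{G(y,x)+\langle y^*,y\rangle-\langle x^*,x\rangle\}$. $\mathsf{Gauss}$: objects $\mathbb R^n$, $\mathbb R^m\otimes\mathbb R^n=\mathbb R^{m+n}$; morphisms $\mathbb R^m\to\mathbb R^n$ are triples $(A,\mu,\Sigma)$ with $A\in\mathbb R^{n\times m}$,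 $\mu\in\mathbb R^n$, $\Sigma\in\mathbb R^{n\times n}$ (symmetric) positive semidefinite; composition $(A,\mu,\Sigma)\circ(B,\mu',\Sigma')=(AB,\mu+A\mu',\Sigma+A\Sigma'A^T)$; tensor $(A\oplus B,\mu\oplus\mu',\Sigma\oplus\Sigma')$ (block-diagonal); identities and symmetries are given by the corresponding linear maps with $\mu=0,\Sigma=0$; copy and discard are $(\Delta,0,0)$ and $(!,0,0)$ with $\Delta:x\mapsto(x,x)$ and $!:\mathbb R^n\to\mathbb R^0$. A generalized inverse of a matrix $\Sigma$ is a matrix $\Sigma^-$ with $\Sigma\Sigma^-\Sigma=\Sigma$. (When $z\notin S$ the value of $\mathrm{logpdf}_f(y,x)$ is $-\infty$.) *)

(* Defs.v *)
From HB Require Import structures.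
From mathcomp Require Import all_boot all_order all_algebra.
From mathcomp Require Import all_classical all_reals all_analysis.
From mathcomp Require Import ring lra.

Set Implicit Arguments.
Unset Strict Implicit.
Unset Printing Implicit Defensive.

Import Order.TTheory GRing.Theory Num.Theory.

Local Open Scope classical_set_scope.
Local Open Scope ring_scope.

#[local] Obligation Tactic := idtac.

(** * Strict symmetric monoidal and copy-delete categories on objects R^n

    The object R^n is represented by [n : nat]; the tensor product of objects
    is [addn] and the unit is [0].  Strictness is expressed by transporting
    morphisms along equalities of natural numbers. *)

Definition hom_cast (H : nat -> nat -> Type) m m' n n'
    (em : m = m') (en : n = n') (f : H m n) : H m' n' :=
  match em in _ = k, en in _ = l return H k l with erefl, erefl => f end.

Lemma addnACA_mid m n p q : (m + ((n + p) + q) = (m + n) + (p + q))%N.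
Proof. by rewrite !addnA. Qed.

Structure smcat := SMCat {
  hom :> nat -> nat -> Type;
  cat_id : forall n, hom n n;
  cat_comp : forall m n p, hom n p -> hom m n -> hom m p;
  cat_tens : forall m n p q, hom m n -> hom p q -> hom (m + p)%N (n + q)%N;
  cat_swap : forall m n, hom (m + n)%N (n + m)%N;
  comp_idl : forall m n (f : hom m n), cat_comp (cat_id n) f = f;
  comp_idr : forall m n (f : hom m n), cat_comp f (cat_id m) = f;
  comp_assoc : forall m n p q (h : hom p q) (g : hom n p) (f : hom m n),
    cat_comp h (cat_comp g f) = cat_comp (cat_comp h g) f;
  tens_id : forall m n, cat_tens (cat_id m) (cat_id n) = cat_id (m + n)%N;
  tens_comp : forall m n p m' n' p'
      (g : hom n p) (f : hom m n) (g' : hom n' p') (f' : hom m' n'),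
    cat_tens (cat_comp g f) (cat_comp g' f') = cat_comp (cat_tens g g') (cat_tens f f');
  tens_assoc : forall m n p q r s (f : hom m n) (g : hom p q) (h : hom r s),
    hom_cast (addnA m p r) (addnA n q s) (cat_tens f (cat_tens g h)) =
    cat_tens (cat_tens f g) h;
  tens_unitl : forall m n (f : hom m n),
    hom_cast (add0n m) (add0n n) (cat_tens (cat_id 0) f) = f;
  tens_unitr : forall m n (f : hom m n),
    hom_cast (addn0 m) (addn0 n) (cat_tens f (cat_id 0)) = f;
  swap_nat : forall m n p q (f : hom m n) (g : hom p q),
    cat_comp (cat_swap n q) (cat_tens f g) = cat_comp (cat_tens g f) (cat_swap m p);
  swapK : forall m n, cat_comp (cat_swap n m) (cat_swap m n) = cat_id (m + n)%N;
  swap_hexl : forall m n p,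
    cat_swap m (n + p)%N =
    cat_comp (hom_cast erefl (addnA n p m) (cat_tens (cat_id n) (cat_swap m p)))
         (hom_cast (esym (addnA m n p)) (esym (addnA n m p))
                   (cat_tens (cat_swap m n) (cat_id p)));
  swap_hexr : forall m n p,
    cat_swap (m + n)%N p =
    cat_comp (hom_cast (esym (addnA m p n)) (esym (addnA p m n))
                   (cat_tens (cat_swap m p) (cat_id n)))
         (hom_cast (addnA m n p) erefl (cat_tens (cat_id m) (cat_swap n p)))
}.

Arguments cat_id {_} n.
Arguments cat_comp {_ m n p} _ _.
Arguments cat_tens {_ m n p q} _ _.
Arguments cat_swap {_} m n.

Structure cdcat := CDCat {
  cd_smcat :> smcat;
  copy : forall n, cd_smcat n (n + n)%N;
  discard : forall n, cd_smcat n 0%N;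
  copy_assoc : forall n,
    hom_cast erefl (addnA n n n) (cat_comp (cat_tens (cat_id n) (copy n)) (copy n)) =
    cat_comp (cat_tens (copy n) (cat_id n)) (copy n);
  copy_unitl : forall n,
    hom_cast erefl (add0n n) (cat_comp (cat_tens (discard n) (cat_id n)) (copy n)) =
    cat_id n;
  copy_unitr : forall n,
    hom_cast erefl (addn0 n) (cat_comp (cat_tens (cat_id n) (discard n)) (copy n)) =
    cat_id n;
  copy_comm : forall n, cat_comp (cat_swap n n) (copy n) = copy n;
  copy_tens : forall m n,
    copy (m + n)%N =
    cat_comp (hom_cast (addnACA_mid m m n n) (addnACA_mid m n m n)
            (cat_tens (cat_id m) (cat_tens (cat_swap m n) (cat_id n))))
         (cat_tens (copy m) (copy n));
  discard_tens : forall m n,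
    discard (m + n)%N =
    hom_cast erefl (addn0 0) (cat_tens (discard m) (discard n));
  copy_unit : copy 0%N = hom_cast erefl (esym (addn0 0)) (cat_id 0%N);
  discard_unit : discard 0%N = cat_id 0%N
}.

Arguments copy {_} n.
Arguments discard {_} n.

(** Strict symmetric monoidal functors that are the identity on objects and
    preserve copy and discard. *)
Record is_cd_functor (C D : cdcat) (F : forall m n, C m n -> D m n) : Prop := {
  cdf_id : forall n, F n n (cat_id n) = cat_id n;
  cdf_comp : forall m n p (g : C n p) (f : C m n),
    F m p (cat_comp g f) = cat_comp (F n p g) (F m n f);
  cdf_tens : forall m n p q (f : C m n) (g : C p q),
    F _ _ (cat_tens f g) = cat_tens (F m n f) (F p q g);
  cdf_swap : forall m n, F _ _ (cat_swap m n) = cat_swap m n;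
  cdf_copy : forall n, F _ _ (copy n) = copy n;
  cdf_discard : forall n, F _ _ (discard n) = discard n
}.

Lemma hom_cast_irr (H : nat -> nat -> Type) m m' n n' (e1 e2 : m = m')
  (e3 e4 : n = n') (f : H m n) : hom_cast e1 e3 f = hom_cast e2 e4 f.
Proof. by rewrite (eq_irrelevance e1 e2) (eq_irrelevance e3 e4). Qed.

Lemma hom_cast_map (H K : nat -> nat -> Type) (F : forall m n, H m n -> K m n)
  m m' n n' (em : m = m') (en : n = n') (f : H m n) :
  F _ _ (hom_cast em en f) = hom_cast em en (F _ _ f).
Proof. by case: _ / em; case: _ / en. Qed.

Lemma hom_cast_flip (H : nat -> nat -> Type)
  m m' n n' (em : m = m') (en : n = n') (f : H n m) :
  hom_cast em en (f : (fun a b => H b a) m n) = hom_cast en em f :> H n' m'.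
Proof. by case: _ / em; case: _ / en. Qed.

Lemma hom_castK (H : nat -> nat -> Type) m m' n n'
    (em : m = m') (en : n = n') (f : H m n) :
  hom_cast (esym em) (esym en) (hom_cast em en f) = f.
Proof. by case: _ / em; case: _ / en. Qed.

Lemma hom_cast_comp (C : smcat) m m' n n' p p' (em : m = m') (en : n = n')
    (ep : p = p') (g : C n p) (f : C m n) :
  hom_cast em ep (cat_comp g f) = cat_comp (hom_cast en ep g) (hom_cast em en f).
Proof. by case: _ / em; case: _ / en; case: _ / ep. Qed.

Section Opposite.
Variable C : smcat.

Definition smop : smcat.
Proof.
refine (@SMCat (fun m n => C n m) (fun n => cat_id n)
  (fun m n p g f => cat_comp f g) (fun m n p q f g => cat_tens f g)
  (fun m n => cat_swap n m) _ _ _ _ _ _ _ _ _ _ _ _).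
- by move=> m n f; rewrite comp_idr.
- by move=> m n f; rewrite comp_idl.
- by move=> m n p q h g f; rewrite comp_assoc.
- by move=> m n; rewrite tens_id.
- by move=> *; rewrite tens_comp.
- by move=> m n p q r s f g h; rewrite (hom_cast_flip (H:=hom C)) tens_assoc.
- by move=> m n f; rewrite (hom_cast_flip (H:=hom C)) tens_unitl.
- by move=> m n f; rewrite (hom_cast_flip (H:=hom C)) tens_unitr.
- by move=> m n p q f g; rewrite swap_nat.
- by move=> m n; rewrite swapK.
- move=> m n p; rewrite !(hom_cast_flip (H:=hom C)) swap_hexr.
  by congr cat_comp; apply: hom_cast_irr.
- move=> m n p; rewrite !(hom_cast_flip (H:=hom C)) swap_hexl.
  by congr cat_comp; apply: hom_cast_irr.
Defined.

End Opposite.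

(** * Linear maps *)

Section LinearMaps.
Variable R : comNzRingType.

Definition swap_mx m n : 'M[R]_(n + m, m + n) := block_mx 0 1%:M 1%:M 0.
Definition dup_mx n : 'M[R]_(n + n, n) := col_mx 1%:M 1%:M.
Definition bang_mx n : 'M[R]_(0, n) := 0.

Lemma eq_mx_mulv m n (A B : 'M[R]_(m, n)) :
  (forall x : 'cV_n, A *m x = B *m x) -> A = B.
Proof.
move=> AB; apply/matrixP => i j; have /matrixP/(_ i 0) := AB (delta_mx j 0).
by rewrite -!colE !mxE.
Qed.

Lemma hom_cast_mulv m m' n n' (em : m = m') (en : n = n') (A : 'M[R]_(n, m))
    (x : 'cV_m') :
  hom_cast (H := fun a b => 'M[R]_(b, a)) em en A *m x =
  castmx (en, erefl) (A *m castmx (esym em, erefl) x).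
Proof. by case: _ / em x; case: _ / en => x; rewrite /= !castmx_id. Qed.

Lemma castmx_col_mxA m n p (x : 'cV[R]_m) (y : 'cV_n) (z : 'cV_p) e :
  castmx (e, erefl) (col_mx x (col_mx y z)) = col_mx (col_mx x y) z.
Proof. by rewrite col_mxA castmx_comp castmx_id. Qed.

Lemma castmx_col_mxAV m n p (x : 'cV[R]_m) (y : 'cV_n) (z : 'cV_p) e :
  castmx (e, erefl) (col_mx (col_mx x y) z) = col_mx x (col_mx y z).
Proof.
by rewrite -(castmx_col_mxA x y z (addnA m n p)) castmx_comp castmx_id.
Qed.

Lemma castmx_col_mx0l n e (x : 'cV[R]_0) (y : 'cV[R]_n) :
  castmx (e : (0 + n)%N = n, erefl) (col_mx x y) = y.
Proof.
apply/matrixP => i j; rewrite castmxE /= -[RHS](@col_mxEd _ 0 _ _ x y).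
by congr (col_mx _ _ _ _); [apply: val_inj | rewrite !ord1].
Qed.

Lemma castmx_col_mx0r n e (x : 'cV[R]_n) (y : 'cV[R]_0) :
  castmx (e : (n + 0)%N = n, erefl) (col_mx x y) = x.
Proof.
apply/matrixP => i j; rewrite castmxE /= -[RHS](@col_mxEu _ _ 0 _ x y).
by congr (col_mx _ _ _ _); [apply: val_inj | rewrite !ord1].
Qed.

Lemma castmx_col_mxr m n n' (x : 'cV[R]_m) (y : 'cV_n) (e : n = n') e' :
  col_mx x (castmx (e, erefl) y) = castmx (e', erefl) (col_mx x y).
Proof. by case: _ / e e' => e'; rewrite !castmx_id. Qed.

Lemma castmx_col_mxACA m n p q (x : 'cV[R]_m) (y : 'cV_n) (z : 'cV_p)
    (t : 'cV_q) e :
  castmx (e, erefl) (col_mx x (col_mx (col_mx y z) t)) =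
  col_mx (col_mx x y) (col_mx z t).
Proof.
rewrite -(castmx_col_mxA y z t (addnA _ _ _)).
rewrite (castmx_col_mxr _ _ _ (congr1 (addn m) (addnA n p q))) castmx_comp.
exact: castmx_col_mxA.
Qed.

Lemma castmx_col_mxACAV m n p q (x : 'cV[R]_m) (y : 'cV_n) (z : 'cV_p)
    (t : 'cV_q) e :
  castmx (e, erefl) (col_mx (col_mx x y) (col_mx z t)) =
  col_mx x (col_mx (col_mx y z) t).
Proof.
rewrite -(castmx_col_mxACA x y z t (addnACA_mid _ _ _ _)) castmx_comp.
by rewrite castmx_id.
Qed.

Definition dsum_mx m n p q (A : 'M[R]_(n, m)) (B : 'M[R]_(q, p)) :
  'M[R]_(n + q, m + p) := block_mx A 0 0 B.

Lemma dsum_mxv m n p q (A : 'M[R]_(n, m)) (B : 'M[R]_(q, p)) x y :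
  dsum_mx A B *m col_mx x y = col_mx (A *m x) (B *m y) :> 'cV_ _.
Proof. by rewrite mul_block_col !mul0mx addr0 add0r. Qed.

Lemma swap_mxv m n (x : 'cV_m) (y : 'cV_n) :
  swap_mx m n *m col_mx x y = col_mx y x.
Proof. by rewrite mul_block_col !mul0mx !mul1mx addr0 add0r. Qed.

Lemma dup_mxv n (x : 'cV_n) : dup_mx n *m x = col_mx x x.
Proof. by rewrite mul_col_mx mul1mx. Qed.

Lemma bang_mxv n (x : 'cV_n) : bang_mx n *m x = 0.
Proof. exact: mul0mx. Qed.

Let mxE := (hom_cast_mulv, castmx_col_mxA, castmx_col_mxAV, castmx_col_mx0l,
  castmx_col_mx0r, dsum_mxv, swap_mxv, dup_mxv, bang_mxv, mul1mx, castmx_id).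

Ltac dec x := rewrite -[x]vsubmxK;
  let a := fresh "a" in let b := fresh "b" in
  set a := usubmx x; set b := dsubmx x; move: (a) (b).

Lemma swap_mxK m n : swap_mx n m *m swap_mx m n = 1%:M.
Proof.
by apply: eq_mx_mulv => x; dec x => u v; rewrite -mulmxA !mxE.
Qed.

Lemma swap_mx_nat m n p q (A : 'M[R]_(n, m)) (B : 'M[R]_(q, p)) :
  swap_mx n q *m dsum_mx A B = dsum_mx B A *m swap_mx m p.
Proof.
by apply: eq_mx_mulv => x; dec x => u v; rewrite -!mulmxA !mxE.
Qed.

Let cast := @hom_cast (fun a b => 'M[R]_(b, a)).

Lemma swap_mx_hexl m n p :
  swap_mx m (n + p) =
  cast erefl (addnA n p m) (dsum_mx 1%:M (swap_mx m p)) *m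
  cast (esym (addnA m n p)) (esym (addnA n m p))
    (dsum_mx (swap_mx m n) 1%:M).
Proof.
apply: eq_mx_mulv => x; dec x => u v; dec v => v1 v2.
by rewrite -!mulmxA /cast !mxE.
Qed.

Lemma swap_mx_hexr m n p :
  swap_mx (m + n) p =
  cast (esym (addnA m p n)) (esym (addnA p m n))
    (dsum_mx (swap_mx m p) 1%:M) *m
  cast (addnA m n p) erefl (dsum_mx 1%:M (swap_mx n p)).
Proof.
apply: eq_mx_mulv => x; dec x => u v; dec u => u1 u2.
by rewrite -!mulmxA /cast !mxE.
Qed.

Lemma dup_mx_assoc n :
  cast erefl (addnA n n n) (dsum_mx 1%:M (dup_mx n) *m dup_mx n) =
  dsum_mx (dup_mx n) 1%:M *m dup_mx n.
Proof. by apply: eq_mx_mulv => x; rewrite /cast !mxE -!mulmxA !mxE. Qed.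

Lemma dup_mx_unitl n :
  cast erefl (add0n n) (dsum_mx (bang_mx n) 1%:M *m dup_mx n) = 1%:M.
Proof.
apply: eq_mx_mulv => x; rewrite /cast !mxE -!mulmxA !mxE.
by rewrite ?castmx_id -[RHS](castmx_col_mx0l (add0n n) 0 x) castmx_id.
Qed.

Lemma dup_mx_unitr n :
  cast erefl (addn0 n) (dsum_mx 1%:M (bang_mx n) *m dup_mx n) = 1%:M.
Proof. by apply: eq_mx_mulv => x; rewrite /cast !mxE -!mulmxA !mxE. Qed.

Lemma dup_mx_comm n : swap_mx n n *m dup_mx n = dup_mx n.
Proof. by apply: eq_mx_mulv => x; rewrite -!mulmxA !mxE. Qed.

Lemma dsum_mx1 m n : dsum_mx 1%:M 1%:M = (1%:M : 'M[R]_(m + n)).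
Proof. by rewrite /dsum_mx -scalar_mx_block. Qed.

Lemma dsum_mxM m n p m' n' p' (B : 'M[R]_(p, n)) (A : 'M[R]_(n, m))
    (B' : 'M[R]_(p', n')) (A' : 'M[R]_(n', m')) :
  dsum_mx B B' *m dsum_mx A A' = dsum_mx (B *m A) (B' *m A').
Proof. by rewrite mulmx_block !mul0mx !mulmx0 !addr0 !add0r. Qed.

Lemma tr_dsum_mx m n p q (A : 'M[R]_(n, m)) (B : 'M[R]_(q, p)) :
  (dsum_mx A B)^T = dsum_mx A^T B^T.
Proof. by rewrite tr_block_mx !trmx0. Qed.

Lemma tr_swap_mx m n : (swap_mx m n)^T = swap_mx n m.
Proof. by rewrite tr_block_mx !trmx0 !trmx1. Qed.

Lemma dsum_mxA m n p q r s (A : 'M[R]_(n, m)) (B : 'M[R]_(q, p))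
    (C : 'M[R]_(s, r)) :
  cast (addnA m p r) (addnA n q s) (dsum_mx A (dsum_mx B C)) =
  dsum_mx (dsum_mx A B) C.
Proof.
apply: eq_mx_mulv => x; dec x => u v; dec u => u1 u2.
by rewrite /cast !mxE.
Qed.

Lemma dsum_mx0l m n (A : 'M[R]_(n, m)) (B : 'M[R]_0) :
  cast (add0n m) (add0n n) (dsum_mx B A) = A.
Proof.
apply: eq_mx_mulv => x; rewrite -(castmx_col_mx0l (add0n m) 0 x) /cast.
rewrite hom_cast_mulv castmx_comp castmx_id dsum_mxv castmx_col_mx0l.
by rewrite castmx_col_mx0l.
Qed.

Lemma dsum_mx0r m n (A : 'M[R]_(n, m)) (B : 'M[R]_0) :
  cast (addn0 m) (addn0 n) (dsum_mx A B) = A.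
Proof.
apply: eq_mx_mulv => x; rewrite -(castmx_col_mx0r (addn0 m) x 0) /cast.
rewrite hom_cast_mulv castmx_comp castmx_id dsum_mxv castmx_col_mx0r.
by rewrite castmx_col_mx0r.
Qed.

Lemma dup_mx_tens m n :
  dup_mx (m + n) =
  cast (addnACA_mid m m n n) (addnACA_mid m n m n)
    (dsum_mx 1%:M (dsum_mx (swap_mx m n) 1%:M)) *m
  dsum_mx (dup_mx m) (dup_mx n).
Proof.
apply: eq_mx_mulv => x; dec x => u v.
by rewrite -!mulmxA /cast !mxE castmx_col_mxACAV !mxE castmx_col_mxACA.
Qed.

Lemma bang_mx_tens m n :
  bang_mx (m + n) = cast erefl (addn0 0) (dsum_mx (bang_mx m) (bang_mx n)).
Proof. by apply/matrixP => -[]. Qed.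

Lemma dup_mx0 : dup_mx 0 = cast erefl (esym (addn0 0)) 1%:M.
Proof. by apply/matrixP => -[]. Qed.

Lemma bang_mx0 : bang_mx 0 = 1%:M.
Proof. by apply/matrixP => -[]. Qed.

End LinearMaps.

(** The symmetry and comonoid laws hold in any structure into which matrices
    embed compatibly with composition and direct sums. *)
Section LinearStructure.
Variables (R : comNzRingType) (H : nat -> nat -> Type).
Variables (cmp : forall m n p, H n p -> H m n -> H m p).
Variables (tns : forall m n p q, H m n -> H p q -> H (m + p)%N (n + q)%N).
Variable lin : forall m n, 'M[R]_(n, m) -> H m n.
Hypothesis lin_cmp : forall m n p (B : 'M[R]_(p, n)) (A : 'M[R]_(n, m)),
  cmp (lin B) (lin A) = lin (B *m A).
Hypothesis lin_tns : forall m n p q (A : 'M[R]_(n, m)) (B : 'M[R]_(q, p)),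
  tns (lin A) (lin B) = lin (dsum_mx A B).

Let lin_cast m m' n n' (em : m = m') (en : n = n') (A : 'M[R]_(n, m)) :
  hom_cast em en (lin A) =
  lin (hom_cast (H := fun a b => 'M[R]_(b, a)) em en A).
Proof. by case: _ / em; case: _ / en. Qed.

Let sw m n := lin (swap_mx R m n).
Let cp n := lin (dup_mx R n).
Let ds n := lin (bang_mx R n).
Let i n := lin (1%:M : 'M[R]_n).
Let linE := (lin_cmp, lin_tns, lin_cast).

Lemma lin_swapK m n : cmp (sw n m) (sw m n) = i (m + n).
Proof. by rewrite !linE swap_mxK. Qed.

Lemma lin_swap_hexl m n p :
  sw m (n + p) =
  cmp (hom_cast erefl (addnA n p m) (tns (i n) (sw m p)))
      (hom_cast (esym (addnA m n p)) (esym (addnA n m p))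
                (tns (sw m n) (i p))).
Proof. by rewrite !linE -swap_mx_hexl. Qed.

Lemma lin_swap_hexr m n p :
  sw (m + n) p =
  cmp (hom_cast (esym (addnA m p n)) (esym (addnA p m n))
                (tns (sw m p) (i n)))
      (hom_cast (addnA m n p) erefl (tns (i m) (sw n p))).
Proof. by rewrite !linE -swap_mx_hexr. Qed.

Lemma lin_copy_assoc n :
  hom_cast erefl (addnA n n n) (cmp (tns (i n) (cp n)) (cp n)) =
  cmp (tns (cp n) (i n)) (cp n).
Proof. by rewrite !linE dup_mx_assoc. Qed.

Lemma lin_copy_unitl n :
  hom_cast erefl (add0n n) (cmp (tns (ds n) (i n)) (cp n)) = i n.
Proof. by rewrite !linE dup_mx_unitl. Qed.

Lemma lin_copy_unitr n :
  hom_cast erefl (addn0 n) (cmp (tns (i n) (ds n)) (cp n)) = i n.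
Proof. by rewrite !linE dup_mx_unitr. Qed.

Lemma lin_copy_comm n : cmp (sw n n) (cp n) = cp n.
Proof. by rewrite !linE dup_mx_comm. Qed.

Lemma lin_copy_tens m n :
  cp (m + n)%N =
  cmp (hom_cast (addnACA_mid m m n n) (addnACA_mid m n m n)
            (tns (i m) (tns (sw m n) (i n))))
         (tns (cp m) (cp n)).
Proof. by rewrite !linE -dup_mx_tens. Qed.

Lemma lin_discard_tens m n :
  ds (m + n)%N = hom_cast erefl (addn0 0) (tns (ds m) (ds n)).
Proof. by rewrite !linE -bang_mx_tens. Qed.

Lemma lin_copy_unit : cp 0 = hom_cast erefl (esym (addn0 0)) (i 0).
Proof. by rewrite !linE -dup_mx0. Qed.

Lemma lin_discard_unit : ds 0 = i 0.
Proof. by rewrite /ds bang_mx0. Qed.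

End LinearStructure.

(** * The category of Gaussian maps *)

Section Gauss.
Variable R : realType.

Definition dot n (u v : 'cV[R]_n) : R := (u^T *m v) 0 0.

Lemma dot_sum n (u v : 'cV_n) : dot u v = \sum_i u i 0 * v i 0.
Proof. by rewrite /dot mxE; apply: eq_bigr => i _; rewrite mxE. Qed.

Lemma dotC n (u v : 'cV_n) : dot u v = dot v u.
Proof. by rewrite !dot_sum; apply: eq_bigr => i _; rewrite mulrC. Qed.

Lemma dotDr n (u v w : 'cV_n) : dot u (v + w) = dot u v + dot u w.
Proof. by rewrite /dot mulmxDr mxE. Qed.

Lemma dotDl n (u v w : 'cV_n) : dot (u + v) w = dot u w + dot v w.
Proof. by rewrite dotC dotDr !(dotC w). Qed.

Lemma dotZr n a (u v : 'cV_n) : dot u (a *: v) = a * dot u v.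
Proof. by rewrite /dot -scalemxAr mxE. Qed.

Lemma dotZl n a (u v : 'cV_n) : dot (a *: u) v = a * dot u v.
Proof. by rewrite dotC dotZr dotC. Qed.

Lemma dot_mulmx m n (A : 'M[R]_(m, n)) u v :
  dot u (A *m v) = dot (A^T *m u) v.
Proof. by rewrite /dot trmx_mul trmxK mulmxA. Qed.

Lemma dot_col m n (u u' : 'cV_m) (v v' : 'cV_n) :
  dot (col_mx u v) (col_mx u' v') = dot u u' + dot v v'.
Proof. by rewrite /dot tr_col_mx mul_row_col mxE. Qed.

Definition psd n (S : 'M[R]_n) : Prop :=
  S^T = S /\ forall x : 'cV_n, 0 <= dot x (S *m x).

Lemma psd0 n : psd (0 : 'M[R]_n).
Proof. by split=> [|x]; rewrite ?trmx0// mul0mx /dot mulmx0 mxE. Qed.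

Lemma psdD n (S T : 'M[R]_n) : psd S -> psd T -> psd (S + T).
Proof.
move=> [S1 S2] [T1 T2]; split=> [|x]; first by rewrite raddfD /= S1 T1.
by rewrite mulmxDl dotDr addr_ge0.
Qed.

Lemma psd_conj m n (A : 'M[R]_(n, m)) (S : 'M[R]_m) :
  psd S -> psd (A *m S *m A^T).
Proof.
move=> [S1 S2]; split=> [|x]; first by rewrite !trmx_mul trmxK S1 mulmxA.
by rewrite -!mulmxA dot_mulmx.
Qed.

Lemma psd_dsum m n (S : 'M[R]_m) (T : 'M[R]_n) :
  psd S -> psd T -> psd (dsum_mx S T).
Proof.
move=> [S1 S2] [T1 T2]; split=> [|x]; first by rewrite tr_dsum_mx S1 T1.
by rewrite -[x]vsubmxK dsum_mxv dot_col addr_ge0.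
Qed.

(** [Gauss A mu S] is the stochastic map x |-> A x + N(mu, S). *)
Record gauss m n := Gauss {
  gmat : 'M[R]_(n, m);
  gmean : 'cV[R]_n;
  gcov : 'M[R]_n;
  gcov_psd : psd gcov
}.

Lemma gauss_eq m n (f g : gauss m n) :
  gmat f = gmat g -> gmean f = gmean g -> gcov f = gcov g -> f = g.
Proof.
case: f g => [A a S Sp] [B b T Tp] /= eA ea eS; subst.
by rewrite (Prop_irrelevance Sp Tp).
Qed.

Definition gauss_lin m n (A : 'M[R]_(n, m)) : gauss m n :=
  Gauss A 0 (psd0 n).

Definition gauss_id n : gauss n n := gauss_lin 1%:M.

Definition gauss_comp m n p (f : gauss n p) (g : gauss m n) : gauss m p :=
  Gauss (gmat f *m gmat g) (gmean f + gmat f *m gmean g)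
    (psdD (gcov_psd f) (psd_conj (gmat f) (gcov_psd g))).

Definition gauss_tens m n p q (f : gauss m n) (g : gauss p q) :
    gauss (m + p) (n + q) :=
  Gauss (dsum_mx (gmat f) (gmat g)) (col_mx (gmean f) (gmean g))
    (psd_dsum (gcov_psd f) (gcov_psd g)).

Lemma gauss_lin_comp m n p (B : 'M[R]_(p, n)) (A : 'M[R]_(n, m)) :
  gauss_comp (gauss_lin B) (gauss_lin A) = gauss_lin (B *m A).
Proof.
by apply: gauss_eq; rewrite /= ?mulmx0 ?mul0mx ?addr0.
Qed.

Lemma gauss_lin_tens m n p q (A : 'M[R]_(n, m)) (B : 'M[R]_(q, p)) :
  gauss_tens (gauss_lin A) (gauss_lin B) = gauss_lin (dsum_mx A B).
Proof. by apply: gauss_eq; rewrite /= ?col_mx0// /dsum_mx block_mx0. Qed.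

Lemma gmat_cast m m' n n' (em : m = m') (en : n = n') (f : gauss m n) :
  gmat (hom_cast em en f) =
  hom_cast (H := fun a b => 'M[R]_(b, a)) em en (gmat f).
Proof. by case: _ / em; case: _ / en. Qed.

Lemma gmean_cast m m' n n' (em : m = m') (en : n = n') (f : gauss m n) :
  gmean (hom_cast em en f) = castmx (en, erefl) (gmean f).
Proof. by case: _ / em; case: _ / en; rewrite castmx_id. Qed.

Lemma gcov_cast m m' n n' (em : m = m') (en : n = n') (f : gauss m n) :
  gcov (hom_cast em en f) =
  hom_cast (H := fun a b => 'M[R]_(b, a)) en en (gcov f).
Proof. by case: _ / em; case: _ / en. Qed.

Definition gauss_smcat : smcat.
Proof.
refine (@SMCat gauss gauss_id gauss_comp gauss_tens
  (fun m n => gauss_lin (swap_mx R m n)) _ _ _ _ _ _ _ _ _ _ _ _).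
- move=> m n f; apply: gauss_eq; rewrite /= ?mul1mx ?add0r//.
  by rewrite trmx1 mulmx1.
- move=> m n f; apply: gauss_eq; rewrite /= ?mulmx1 ?mulmx0 ?addr0//.
  by rewrite mul0mx addr0.
- move=> m n p q h g f; apply: gauss_eq; rewrite /= ?mulmxA//.
    by rewrite mulmxDr addrA mulmxA.
  by rewrite mulmxDr mulmxDl addrA trmx_mul !mulmxA.
- by move=> m n; rewrite /gauss_id gauss_lin_tens dsum_mx1.
- move=> m n p m' n' p' g f g' f'; apply: gauss_eq => /=.
  + by rewrite dsum_mxM.
  + by rewrite dsum_mxv add_col_mx.
  + rewrite tr_dsum_mx !dsum_mxM /dsum_mx add_block_mx.
    by rewrite !addr0.
- move=> m n p q r s f g h; apply: gauss_eq => /=.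
  + by rewrite gmat_cast /= dsum_mxA.
  + by rewrite gmean_cast /= castmx_col_mxA.
  + by rewrite gcov_cast /= dsum_mxA.
- move=> m n f; apply: gauss_eq => /=.
  + by rewrite gmat_cast /= dsum_mx0l.
  + by rewrite gmean_cast /= castmx_col_mx0l.
  + by rewrite gcov_cast /= dsum_mx0l.
- move=> m n f; apply: gauss_eq => /=.
  + by rewrite gmat_cast /= dsum_mx0r.
  + by rewrite gmean_cast /= castmx_col_mx0r.
  + by rewrite gcov_cast /= dsum_mx0r.
- move=> m n p q f g; apply: gauss_eq => /=.
  + by rewrite swap_mx_nat.
  + by rewrite swap_mxv add0r mulmx0 addr0.
  + rewrite mulmx0 mul0mx addr0 add0r swap_mx_nat tr_swap_mx -mulmxA.
    by rewrite swap_mxK mulmx1.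
- exact: (lin_swapK gauss_lin_comp).
- exact: (lin_swap_hexl gauss_lin_comp gauss_lin_tens).
- exact: (lin_swap_hexr gauss_lin_comp gauss_lin_tens).
Defined.

Definition gauss_cdcat : cdcat.
Proof.
refine (@CDCat gauss_smcat
  (fun n => gauss_lin (dup_mx R n)) (fun n => gauss_lin (bang_mx R n))
  _ _ _ _ _ _ _ _).
- exact: (lin_copy_assoc gauss_lin_comp gauss_lin_tens).
- exact: (lin_copy_unitl gauss_lin_comp gauss_lin_tens).
- exact: (lin_copy_unitr gauss_lin_comp gauss_lin_tens).
- exact: (lin_copy_comm gauss_lin_comp).
- exact: (lin_copy_tens gauss_lin_comp gauss_lin_tens).
- exact: (lin_discard_tens gauss_lin_tens).
- exact: lin_copy_unit.
- exact: lin_discard_unit.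
Defined.

End Gauss.

(** * Convex and concave bifunctions *)

Section ConvexFunctions.
Variable R : realType.

Definition epigraph (V : lmodType R) (h : V -> \bar R) : set (V * R^o) :=
  [set p | (h p.1 <= p.2%:E)%E].

Definition convex_efun (V : lmodType R) (h : V -> \bar R) : Prop :=
  convex_set (epigraph h).

Definition concave_efun (V : lmodType R) (h : V -> \bar R) : Prop :=
  convex_efun (fun v => - h v)%E.

Definition cxindic (P : Prop) : \bar R := if `[< P >] then 0%E else +oo%E.

Lemma convex_efunP (V : lmodType R) (h : V -> \bar R) :
  convex_efun h <->
  forall (u v : V) (a b t : R), 0 < t -> t < 1 ->
    (h u < a%:E)%E -> (h v < b%:E)%E ->
    (h (t *: u + (1 - t) *: v)%R < (t * a + (1 - t) * b)%:E)%E.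
Proof.
split=> [ch u v a b t t0 t1 ha hb|ch].
  have lt_real x (c : R) : (x < c%:E)%E -> exists2 d : R, (x <= d%:E)%E & d < c.
    case: x => [r||] //.
    + by rewrite lte_fin; exists r.
    + by exists (c - 1); rewrite ?leNye// ltrBlDr ltrDl.
  have [a' ha' lta] := lt_real _ _ ha; have [b' hb' ltb] := lt_real _ _ hb.
  have t01 : (0 <= t <= 1)%R by rewrite !ltW.
  have := ch (u, a' : R^o) (v, b' : R^o) (Itv01 (ltW t0) (ltW t1)).
  rewrite !inE /epigraph /= => /(_ ha' hb') /le_lt_trans; apply.
  by rewrite lte_fin ltrD// ltr_pM2l// subr_gt0.
apply/convex_setW => -[u a] [v b]; rewrite !inE /epigraph /=.
move=> ha hb k k0 k1; apply/mem_set/lee_addgt0Pr => e e0.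
have lt_e x (c : R) : (x <= c%:E)%E -> (x < (c + e)%:E)%E.
  by move/le_lt_trans; apply; rewrite lte_fin ltrDl.
have /ltW := ch u v _ _ _ k0 k1 (lt_e _ _ ha) (lt_e _ _ hb).
rewrite -EFinD; congr (_ <= _%:E)%E.
rewrite /= /unstable.onem.
have scaleE (x : R) (y : R^o) : x *: y = x * y :> R by [].
rewrite !scaleE; ring.
Qed.

Lemma eqe_lt (x y : \bar R) :
  (forall c : R, (x < c%:E)%E <-> (y < c%:E)%E) -> x = y.
Proof.
move=> xy; apply/eqP; rewrite eq_le; apply/andP; split.
- case: y xy => [r||] xy; rewrite ?leey//.
  + apply/lee_addgt0Pr => e e0; apply/ltW; rewrite -EFinD; apply/xy.
    by rewrite lte_fin ltrDl.
  + case: x xy => [s||] xy //.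
    * by have := (xy s).2 (ltNyr _); rewrite lte_fin ltxx.
    * by have := (xy 0).2 (ltNyr _).
- case: x xy => [r||] xy; rewrite ?leey//.
  + apply/lee_addgt0Pr => e e0; apply/ltW; rewrite -EFinD; apply/xy.
    by rewrite lte_fin ltrDl.
  + case: y xy => [s||] xy //.
    * by have := (xy s).1 (ltNyr _); rewrite lte_fin ltxx.
    * by have := (xy 0).1 (ltNyr _).
Qed.

Lemma dadde_ltP (x y : \bar R) (c : R) :
  ((x + y)%dE < c%:E)%E <->
  exists a b : R, [/\ (x < a%:E)%E, (y < b%:E)%E & a + b = c].
Proof.
split.
- case: x => [r||]; case: y => [s||] //.
  + rewrite (_ : (_ + _)%dE = (r + s)%:E)// lte_fin => rs; exists (r + (c - r - s) / 2).
    exists (s + (c - r - s) / 2); split; rewrite ?lte_fin; lra.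
  + move=> _; exists (r + 1), (c - r - 1).
    by split; rewrite ?lte_fin ?ltNyr ?ltrDl//; ring.
  + move=> _; exists (c - s - 1), (s + 1).
    by split; rewrite ?lte_fin ?ltNyr ?ltrDl//; ring.
  + by move=> _; exists c, 0; split; rewrite ?ltNyr ?addr0.
- case=> a [b []]; case: x => [r||]; case: y => [s||] //;
    try by move=> *; exact: ltNyr.
  rewrite (_ : (_ + _)%dE = (r + s)%:E)// !lte_fin => ? ? <-.
  exact: ltrD.
Qed.

Lemma cxindic_ltP (P : Prop) (c : R) : (cxindic P < c%:E)%E <-> P /\ 0 < c.
Proof.
by rewrite /cxindic; case: asboolP => HP; rewrite ?lte_fin; split=> // -[].
Qed.

Lemma inf_ltP T (f : T -> \bar R) (c : R) :
  (ereal_inf (range f) < c%:E)%E <-> exists t, (f t < c%:E)%E.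
Proof.
split=> [/ereal_inf_lt[_ [t _ <-]] ?|[t ft]]; first by exists t.
by apply: le_lt_trans ft; apply: ereal_inf_lbound; exists t.
Qed.

Lemma lt_split0 (x : \bar R) (c : R) : (x < c%:E)%E <->
  exists a b : R, [/\ 0 < a, (x < b%:E)%E & a + b = c].
Proof.
split; last first.
  by move=> [a [b [a0 xb <-]]]; apply: lt_trans xb _; rewrite lte_fin ltrDr.
case: x => [r||] // rc.
- move: rc; rewrite lte_fin => rc; exists ((c - r) / 2), ((c + r) / 2).
  by split; rewrite ?lte_fin; lra.
- by exists 1, (c - 1); split; rewrite ?ltNyr//; ring.
Qed.

Lemma oppe_daddeE (x y : \bar R) : (- (x + y) = (- x + - y)%dE)%E.
Proof. by rewrite DualAddTheoryNumDomain.dual_addeE !oppeK. Qed.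

End ConvexFunctions.

Section Bifunctions.
Variable R : realType.

Definition convex_bifn m n (F : 'cV[R]_m -> 'cV[R]_n -> \bar R) : Prop :=
  convex_efun (fun u : 'cV[R]_m * 'cV[R]_n => F u.1 u.2).

Definition concave_bifn m n (F : 'cV[R]_m -> 'cV[R]_n -> \bar R) : Prop :=
  concave_efun (fun u : 'cV[R]_m * 'cV[R]_n => F u.1 u.2).

Record cxbifn m n := CxBifn {
  cx_fun :> 'cV[R]_m -> 'cV[R]_n -> \bar R;
  cx_convex : convex_bifn cx_fun
}.

Record cvbifn m n := CvBifn {
  cv_fun :> 'cV[R]_m -> 'cV[R]_n -> \bar R;
  cv_concave : concave_bifn cv_fun
}.

Arguments cx_convex {m n} c.
Arguments cv_concave {m n} c.

Lemma cxbifn_eq m n (F G : cxbifn m n) : (forall x y, F x y = G x y) -> F = G.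
Proof.
case: F G => [F cF] [G cG] /= FG.
have {}FG : F = G by apply: funext => x; apply: funext => y.
by subst; rewrite (Prop_irrelevance cF cG).
Qed.

Lemma cvbifn_eq m n (F G : cvbifn m n) : (forall x y, F x y = G x y) -> F = G.
Proof.
case: F G => [F cF] [G cG] /= FG.
have {}FG : F = G by apply: funext => x; apply: funext => y.
by subst; rewrite (Prop_irrelevance cF cG).
Qed.

Lemma cxbifn_eq_lt m n (F G : cxbifn m n) :
  (forall x y (c : R), (F x y < c%:E)%E <-> (G x y < c%:E)%E) -> F = G.
Proof. by move=> FG; apply: cxbifn_eq => x y; apply: eqe_lt => c. Qed.

Lemma convex_bifnP m n (F : 'cV[R]_m -> 'cV[R]_n -> \bar R) :
  convex_bifn F <->
  forall x x' y y' (a b t : R), 0 < t -> t < 1 ->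
    (F x y < a%:E)%E -> (F x' y' < b%:E)%E ->
    (F (t *: x + (1 - t) *: x')%R (t *: y + (1 - t) *: y')%R
       < (t * a + (1 - t) * b)%:E)%E.
Proof.
split=> [/convex_efunP cF x x' y y' a b t t0 t1 Fa Fb|cF].
  exact: (cF (x, y) (x', y') a b t).
by apply/convex_efunP => -[x y] [x' y'] a b t /=; apply: cF.
Qed.

Lemma cxindic_convex m n (P : 'cV[R]_m -> 'cV[R]_n -> Prop) :
  (forall x x' y y' (t : R), P x y -> P x' y' ->
    P (t *: x + (1 - t) *: x') (t *: y + (1 - t) *: y')) ->
  convex_bifn (fun x y => cxindic R (P x y)).
Proof.
move=> cP; apply/convex_bifnP => x x' y y' a b t t0 t1.
move=> /cxindic_ltP[Pa a0] /cxindic_ltP[Pb b0]; apply/cxindic_ltP; split.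
  exact: cP.
by rewrite addr_gt0// mulr_gt0// subr_gt0.
Qed.

(** ** Convex bifunctions

    [+] in [%dE] is the addition on [\bar R] with (+oo) + (-oo) = +oo. *)

Program Definition cx_id n : cxbifn n n :=
  @CxBifn n n (fun x y : 'cV_n => cxindic R (x = y)) _.
Next Obligation.
move=> n.
by apply: cxindic_convex => x x' y y' t -> ->.
Qed.

Program Definition cx_comp m n p (F : cxbifn n p) (G : cxbifn m n) : cxbifn m p :=
  @CxBifn m p (fun x z => ereal_inf (range (fun y => (G x y + F y z)%dE))) _.
Next Obligation.
move=> m n p F G.
apply/convex_bifnP => x x' z z' a b t t0 t1.
move=> /inf_ltP[y /dadde_ltP[a1 [a2 [Ga Fa <-]]]].
move=> /inf_ltP[y' /dadde_ltP[b1 [b2 [Gb Fb <-]]]].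
apply/inf_ltP; exists (t *: y + (1 - t) *: y'); apply/dadde_ltP.
exists (t * a1 + (1 - t) * b1), (t * a2 + (1 - t) * b2); split.
- by have /convex_bifnP/(_ _ _ _ _ _ _ _ t0 t1 Ga Gb) := cx_convex G.
- by have /convex_bifnP/(_ _ _ _ _ _ _ _ t0 t1 Fa Fb) := cx_convex F.
- by ring.
Qed.

Program Definition cx_tens m n p q (F : cxbifn m n) (G : cxbifn p q) : cxbifn (m + p) (n + q) :=
  @CxBifn (m + p) (n + q) (fun (x : 'cV_(m + p)) (y : 'cV_(n + q)) =>
    (F (usubmx x) (usubmx y) + G (dsubmx x) (dsubmx y))%dE) _.
Next Obligation.
move=> m n p q F G.
apply/convex_bifnP => x x' y y' a b t t0 t1.
move=> /dadde_ltP[a1 [a2 [Fa Ga <-]]] /dadde_ltP[b1 [b2 [Fb Gb <-]]].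
rewrite !linearP !linearZ /=; apply/dadde_ltP.
exists (t * a1 + (1 - t) * b1), (t * a2 + (1 - t) * b2); split.
- by have /convex_bifnP/(_ _ _ _ _ _ _ _ t0 t1 Fa Fb) := cx_convex F.
- by have /convex_bifnP/(_ _ _ _ _ _ _ _ t0 t1 Ga Gb) := cx_convex G.
- by ring.
Qed.

Program Definition cx_swap m n : cxbifn (m + n) (n + m) :=
  @CxBifn (m + n) (n + m) (fun (x : 'cV_(m + n)) (y : 'cV_(n + m)) =>
    cxindic R (usubmx x = dsubmx y /\ dsubmx x = usubmx y)) _.
Next Obligation.
move=> m n.
by apply: cxindic_convex => x x' y y' t; rewrite !linearP !linearZ /=
  => -[-> ->] [-> ->].
Qed.

Program Definition cx_copy n : cxbifn n (n + n) :=
  @CxBifn n (n + n) (fun (z : 'cV_n) (u : 'cV_(n + n)) =>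
    cxindic R (usubmx u + dsubmx u = z)) _.
Next Obligation.
move=> n.
apply: cxindic_convex => x x' y y' t <- <-; rewrite !linearP !linearZ /=.
by rewrite !scalerDr addrACA.
Qed.

Program Definition cx_discard n : cxbifn n 0 :=
  @CxBifn n 0 (fun (x : 'cV_n) (_ : 'cV_0) => cxindic R (x = 0)) _.
Next Obligation.
move=> n.
by apply: cxindic_convex => x x' y y' t -> ->; rewrite !scaler0 addr0.
Qed.

Lemma cx_lin_convex m n (A : 'M[R]_(n, m)) :
  convex_bifn (fun x y => cxindic R (x = A^T *m y)).
Proof.
by apply: cxindic_convex => x x' y y' t -> ->; rewrite mulmxDr -!scalemxAr.
Qed.

Definition cx_lin m n (A : 'M[R]_(n, m)) : cxbifn m n :=
  CxBifn (@cx_lin_convex _ _ A).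

Lemma cx_lin_comp m n p (B : 'M[R]_(p, n)) (A : 'M[R]_(n, m)) :
  cx_comp (cx_lin B) (cx_lin A) = cx_lin (B *m A).
Proof.
apply: cxbifn_eq_lt => x z c; split.
- move=> /inf_ltP[y /dadde_ltP[a [b [/cxindic_ltP[-> a0] /cxindic_ltP[-> b0] <-]]]].
  by apply/cxindic_ltP; rewrite trmx_mul mulmxA addr_gt0.
- move=> /cxindic_ltP[-> c0]; apply/inf_ltP; exists (B^T *m z).
  apply/dadde_ltP; exists (c / 2), (c / 2); split.
  + by apply/cxindic_ltP; rewrite trmx_mul mulmxA divr_gt0.
  + by apply/cxindic_ltP; rewrite divr_gt0.
  + by field.
Qed.

Lemma mul_tr_dsum m n p q (A : 'M[R]_(n, m)) (B : 'M[R]_(q, p))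
    (y : 'cV_(n + q)) :
  (dsum_mx A B)^T *m y = col_mx (A^T *m usubmx y) (B^T *m dsubmx y).
Proof. by rewrite -[y in LHS]vsubmxK tr_dsum_mx dsum_mxv. Qed.

Lemma cx_lin_tens m n p q (A : 'M[R]_(n, m)) (B : 'M[R]_(q, p)) :
  cx_tens (cx_lin A) (cx_lin B) = cx_lin (dsum_mx A B).
Proof.
apply: cxbifn_eq_lt => x y c; split.
- move=> /dadde_ltP[a [b [/cxindic_ltP[xA a0] /cxindic_ltP[xB b0] <-]]].
  apply/cxindic_ltP; split; last exact: addr_gt0.
  by rewrite mul_tr_dsum -xA -xB vsubmxK.
- move=> /cxindic_ltP[-> c0]; rewrite mul_tr_dsum.
  apply/dadde_ltP; exists (c / 2), (c / 2).
  split; last by field.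
  + by apply/cxindic_ltP; rewrite col_mxKu divr_gt0.
  + by apply/cxindic_ltP; rewrite col_mxKd divr_gt0.
Qed.

Lemma cx_id_lin n : cx_id n = cx_lin (1%:M : 'M[R]_n).
Proof. by apply: cxbifn_eq => x y /=; rewrite trmx1 mul1mx. Qed.

Lemma cx_swap_lin m n : cx_swap m n = cx_lin (swap_mx R m n).
Proof.
apply: cxbifn_eq => x y /=; congr cxindic; apply/propext.
rewrite tr_swap_mx -[y in X in _ <-> X]vsubmxK swap_mxv -[x in X in _ <-> X]vsubmxK.
split=> [[-> ->]//|/eq_col_mx[]]; by [].
Qed.

Lemma tr_dup_mxv n (u : 'cV_(n + n)) :
  (dup_mx R n)^T *m u = usubmx u + dsubmx u.
Proof. by rewrite tr_col_mx -[u in LHS]vsubmxK mul_row_col !trmx1 !mul1mx. Qed.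

Lemma cx_copy_lin n : cx_copy n = cx_lin (dup_mx R n).
Proof.
apply: cxbifn_eq => x y /=; rewrite tr_dup_mxv.
by congr cxindic; apply/propext; split=> ->.
Qed.

Lemma cx_discard_lin n : cx_discard n = cx_lin (bang_mx R n).
Proof. by apply: cxbifn_eq => x y /=; rewrite trmx0 mul0mx. Qed.

Lemma cx_castE m m' n n' (em : m = m') (en : n = n') (F : cxbifn m n) x y :
  (hom_cast (H := cxbifn) em en F : cxbifn m' n') x y =
  F (castmx (esym em, erefl) x) (castmx (esym en, erefl) y).
Proof. by case: _ / em x; case: _ / en y => x y; rewrite !castmx_id. Qed.

Lemma cx_comp_idl m n (F : cxbifn m n) : cx_comp (cx_id n) F = F.
Proof.
apply: cxbifn_eq_lt => x z c; split.
- move=> /inf_ltP[y /dadde_ltP[b [a [xb /cxindic_ltP[<- a0] <-]]]].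
  by apply/lt_split0; exists a, b; rewrite addrC.
- move=> /lt_split0[a [b [a0 Fb <-]]].
  apply/inf_ltP; exists z; apply/dadde_ltP; exists b, a.
  by split=> //; [apply/cxindic_ltP | rewrite addrC].
Qed.

Lemma cx_comp_idr m n (F : cxbifn m n) : cx_comp F (cx_id m) = F.
Proof.
apply: cxbifn_eq_lt => x z c; split.
- move=> /inf_ltP[y /dadde_ltP[a [b [/cxindic_ltP[<- a0] xb <-]]]].
  by apply/lt_split0; exists a, b.
- move=> /lt_split0[a [b [a0 Fb <-]]].
  apply/inf_ltP; exists x; apply/dadde_ltP; exists a, b.
  by split=> //; apply/cxindic_ltP.
Qed.

Lemma cx_comp_assoc m n p q (H : cxbifn p q) (G : cxbifn n p)
  (F : cxbifn m n) : cx_comp H (cx_comp G F) = cx_comp (cx_comp H G) F.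
Proof.
apply: cxbifn_eq_lt => x z c; split.
- move=> /inf_ltP[w /dadde_ltP[ab [d [/inf_ltP[y]]]]].
  move=> /dadde_ltP[a [b [Fa Gb <-]]] Hd <-.
  apply/inf_ltP; exists y; apply/dadde_ltP; exists a, (b + d).
  split=> //; last by rewrite addrA.
  by apply/inf_ltP; exists w; apply/dadde_ltP; exists b, d.
- move=> /inf_ltP[y /dadde_ltP[a [bd [Fa /inf_ltP[w]]]]].
  move=> /dadde_ltP[b [d [Gb Hd <-]]] <-.
  apply/inf_ltP; exists w; apply/dadde_ltP; exists (a + b), d.
  split=> //; last by rewrite addrA.
  by apply/inf_ltP; exists y; apply/dadde_ltP; exists a, b.
Qed.

Lemma cx_tens_comp m n p m' n' p'
    (G : cxbifn n p) (F : cxbifn m n) (G' : cxbifn n' p') (F' : cxbifn m' n') :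
  cx_tens (cx_comp G F) (cx_comp G' F') =
  cx_comp (cx_tens G G') (cx_tens F F').
Proof.
apply: cxbifn_eq_lt => x z c; split.
- move=> /dadde_ltP[a [a' [/inf_ltP[y ya] /inf_ltP[y' ya'] <-]]].
  move: ya ya' => /dadde_ltP[b [d [Fb Gd <-]]] /dadde_ltP[b' [d' [Fb' Gd' <-]]].
  apply/inf_ltP; exists (col_mx y y'); apply/dadde_ltP.
  exists (b + b'), (d + d'); split; last by ring.
  + by apply/dadde_ltP; exists b, b'; rewrite col_mxKu col_mxKd.
  + by apply/dadde_ltP; exists d, d'; rewrite col_mxKu col_mxKd.
- move=> /inf_ltP[y /dadde_ltP[bb [dd [/dadde_ltP[b [b' [Fb Fb' <-]]]]]]].
  move=> /dadde_ltP[d [d' [Gd Gd' <-]]] <-.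
  apply/dadde_ltP; exists (b + d), (b' + d'); split; last by ring.
  + by apply/inf_ltP; exists (usubmx y); apply/dadde_ltP; exists b, d.
  + by apply/inf_ltP; exists (dsubmx y); apply/dadde_ltP; exists b', d'.
Qed.

Lemma cx_tens_assoc m n p q r s (F : cxbifn m n) (G : cxbifn p q)
    (H : cxbifn r s) :
  hom_cast (addnA m p r) (addnA n q s) (cx_tens F (cx_tens G H)) =
  cx_tens (cx_tens F G) H.
Proof.
apply: cxbifn_eq => x y; rewrite cx_castE.
rewrite -[x]vsubmxK -[usubmx x]vsubmxK -[y]vsubmxK -[usubmx y]vsubmxK.
rewrite !castmx_col_mxAV /= !(col_mxKu, col_mxKd).
exact: (@addrA (\bar^d R)).
Qed.

Lemma cx_tens_unitl m n (F : cxbifn m n) :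
  hom_cast (add0n m) (add0n n) (cx_tens (cx_id 0) F) = F.
Proof.
apply: cxbifn_eq => x y.
rewrite cx_castE -[x in LHS](castmx_col_mx0l (add0n m) 0).
rewrite -[y in LHS](castmx_col_mx0l (add0n n) 0) !castmx_comp !castmx_id.
rewrite /= !col_mxKu !col_mxKd /cxindic asboolT//.
exact: (@add0r (\bar^d R)).
Qed.

Lemma cx_tens_unitr m n (F : cxbifn m n) :
  hom_cast (addn0 m) (addn0 n) (cx_tens F (cx_id 0)) = F.
Proof.
apply: cxbifn_eq => x y.
rewrite cx_castE -[x in LHS](castmx_col_mx0r (addn0 m) _ 0).
rewrite -[y in LHS](castmx_col_mx0r (addn0 n) _ 0) !castmx_comp !castmx_id.
rewrite /= !col_mxKu !col_mxKd /cxindic asboolT//.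
exact: (@addr0 (\bar^d R)).
Qed.

Lemma cx_swap_nat m n p q (F : cxbifn m n) (G : cxbifn p q) :
  cx_comp (cx_swap n q) (cx_tens F G) = cx_comp (cx_tens G F) (cx_swap m p).
Proof.
apply: cxbifn_eq_lt => x z c; split.
- move=> /inf_ltP[y /dadde_ltP[ab [e [/dadde_ltP[a [b [Fa Gb <-]]]]]]].
  move=> /cxindic_ltP[[yz zy] e0] <-.
  apply/inf_ltP; exists (col_mx (dsubmx x) (usubmx x)); apply/dadde_ltP.
  exists e, (b + a); split; last by ring.
  + by apply/cxindic_ltP; rewrite col_mxKu col_mxKd.
  + apply/dadde_ltP; exists b, a.
    by rewrite col_mxKu col_mxKd -yz -zy.
- move=> /inf_ltP[y /dadde_ltP[e [ab [/cxindic_ltP[[xy yx] e0]]]]].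
  move=> /dadde_ltP[b [a [Gb Fa <-]]] <-.
  apply/inf_ltP; exists (col_mx (dsubmx z) (usubmx z)); apply/dadde_ltP.
  exists (a + b), e; split; last by ring.
  + apply/dadde_ltP; exists a, b.
    by rewrite col_mxKu col_mxKd xy yx.
  + by apply/cxindic_ltP; rewrite col_mxKu col_mxKd.
Qed.

Definition cxBiFn_smcat : smcat.
Proof.
refine (@SMCat cxbifn cx_id cx_comp cx_tens cx_swap _ _ _ _ _ _ _ _ _ _ _ _).
- exact: cx_comp_idl.
- exact: cx_comp_idr.
- exact: cx_comp_assoc.
- by move=> m n; rewrite !cx_id_lin cx_lin_tens dsum_mx1.
- exact: cx_tens_comp.
- exact: cx_tens_assoc.
- exact: cx_tens_unitl.
- exact: cx_tens_unitr.
- exact: cx_swap_nat.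
- by move=> m n; rewrite !cx_swap_lin cx_id_lin (lin_swapK cx_lin_comp).
- move=> m n p; rewrite !cx_swap_lin !cx_id_lin.
  exact: (lin_swap_hexl cx_lin_comp cx_lin_tens).
- move=> m n p; rewrite !cx_swap_lin !cx_id_lin.
  exact: (lin_swap_hexr cx_lin_comp cx_lin_tens).
Defined.

Definition cxBiFn_cdcat : cdcat.
Proof.
refine (@CDCat cxBiFn_smcat cx_copy cx_discard _ _ _ _ _ _ _ _) => /=.
- move=> n; rewrite !cx_copy_lin !cx_id_lin.
  exact: (lin_copy_assoc cx_lin_comp cx_lin_tens).
- move=> n; rewrite !cx_copy_lin !cx_discard_lin !cx_id_lin.
  exact: (lin_copy_unitl cx_lin_comp cx_lin_tens).
- move=> n; rewrite !cx_copy_lin !cx_discard_lin !cx_id_lin.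
  exact: (lin_copy_unitr cx_lin_comp cx_lin_tens).
- move=> n; rewrite !cx_copy_lin !cx_swap_lin.
  exact: (lin_copy_comm cx_lin_comp).
- move=> m n; rewrite !cx_copy_lin !cx_swap_lin !cx_id_lin.
  exact: (lin_copy_tens cx_lin_comp cx_lin_tens).
- move=> m n; rewrite !cx_discard_lin.
  exact: (lin_discard_tens cx_lin_tens).
- rewrite cx_copy_lin cx_id_lin.
  exact: lin_copy_unit.
- by rewrite cx_discard_lin cx_id_lin; exact: lin_discard_unit.
Defined.

(** ** Concave bifunctions

    [+] in [%E] is the addition on [\bar R] with (+oo) + (-oo) = -oo. *)

Definition cx_of_cv m n (F : cvbifn m n) : cxbifn m n :=
  @CxBifn m n (fun x y => - F x y)%E (cv_concave F).

Lemma cx_of_cv_inj m n (F G : cvbifn m n) :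
  cx_of_cv F = cx_of_cv G -> F = G.
Proof.
move=> FG; apply: cvbifn_eq => x y; apply: oppe_inj.
by have := congr1 (fun K : cxbifn m n => K x y) FG.
Qed.

Lemma concave_bifn_of m n (F : 'cV[R]_m -> 'cV[R]_n -> \bar R)
    (G : cxbifn m n) :
  (forall x y, - F x y = G x y)%E -> concave_bifn F.
Proof.
move=> FG; rewrite /concave_bifn /concave_efun.
rewrite (_ : (fun u => _) = fun u : 'cV_m * 'cV_n => G u.1 u.2); last first.
  by apply: funext => u; rewrite FG.
exact: cx_convex.
Qed.

Program Definition cv_id n : cvbifn n n :=
  @CvBifn n n (fun x y : 'cV_n => - cxindic R (x = y))%E _.
Next Obligation.
move=> n.
by apply: (concave_bifn_of (G := cx_id n)) => x y; rewrite oppeK.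
Qed.

Lemma oppe_sup_daddE T (f g : T -> \bar R) :
  (- ereal_sup (range (fun t => f t + g t)) =
   ereal_inf (range (fun t => (- f t + - g t)%dE)))%E.
Proof.
rewrite -ereal_infN; congr ereal_inf; rewrite image_comp.
by apply: eq_imagel => t _ /=; rewrite oppe_daddeE.
Qed.

Program Definition cv_comp m n p (F : cvbifn n p) (G : cvbifn m n) : cvbifn m p :=
  @CvBifn m p (fun x z => ereal_sup (range (fun y => (G x y + F y z)%E))) _.
Next Obligation.
move=> m n p F G.
apply: (concave_bifn_of (G := cx_comp (cx_of_cv F) (cx_of_cv G))) => x y.
by rewrite oppe_sup_daddE.
Qed.

Program Definition cv_tens m n p q (F : cvbifn m n) (G : cvbifn p q) : cvbifn (m + p) (n + q) :=
  @CvBifn (m + p) (n + q) (fun (x : 'cV_(m + p)) (y : 'cV_(n + q)) =>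
    (F (usubmx x) (usubmx y) + G (dsubmx x) (dsubmx y))%E) _.
Next Obligation.
move=> m n p q F G.
apply: (concave_bifn_of (G := cx_tens (cx_of_cv F) (cx_of_cv G))) => x y.
by rewrite oppe_daddeE.
Qed.

Program Definition cv_swap m n : cvbifn (m + n) (n + m) :=
  @CvBifn (m + n) (n + m) (fun (x : 'cV_(m + n)) (y : 'cV_(n + m)) =>
    - cxindic R (usubmx x = dsubmx y /\ dsubmx x = usubmx y))%E _.
Next Obligation.
move=> m n.
by apply: (concave_bifn_of (G := cx_swap m n)) => x y; rewrite oppeK.
Qed.

Let negE_id n : cx_of_cv (cv_id n) = cx_id n.
Proof. by apply: cxbifn_eq => x y /=; rewrite oppeK. Qed.

Let negE_comp m n p (F : cvbifn n p) (G : cvbifn m n) :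
  cx_of_cv (cv_comp F G) = cx_comp (cx_of_cv F) (cx_of_cv G).
Proof. by apply: cxbifn_eq => x y /=; rewrite oppe_sup_daddE. Qed.

Let negE_tens m n p q (F : cvbifn m n) (G : cvbifn p q) :
  cx_of_cv (cv_tens F G) = cx_tens (cx_of_cv F) (cx_of_cv G).
Proof. by apply: cxbifn_eq => x y /=; rewrite oppe_daddeE. Qed.

Let negE_swap m n : cx_of_cv (cv_swap m n) = cx_swap m n.
Proof. by apply: cxbifn_eq => x y /=; rewrite oppeK. Qed.

Let negE_cast m m' n n' (em : m = m') (en : n = n') (F : cvbifn m n) :
  cx_of_cv (hom_cast em en F) = hom_cast em en (cx_of_cv F).
Proof. exact: hom_cast_map. Qed.

Let negE := (negE_id, negE_comp, negE_tens, negE_swap, negE_cast).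

Definition cvBiFn_smcat : smcat.
Proof.
refine (@SMCat cvbifn cv_id cv_comp cv_tens cv_swap _ _ _ _ _ _ _ _ _ _ _ _);
  intros; apply: cx_of_cv_inj; rewrite !negE.
- exact: (@comp_idl cxBiFn_smcat).
- exact: (@comp_idr cxBiFn_smcat).
- exact: (@comp_assoc cxBiFn_smcat).
- exact: (@tens_id cxBiFn_smcat).
- exact: (@tens_comp cxBiFn_smcat).
- exact: (@tens_assoc cxBiFn_smcat).
- exact: (@tens_unitl cxBiFn_smcat).
- exact: (@tens_unitr cxBiFn_smcat).
- exact: (@swap_nat cxBiFn_smcat).
- exact: (@swapK cxBiFn_smcat).
- exact: (@swap_hexl cxBiFn_smcat).
- exact: (@swap_hexr cxBiFn_smcat).
Defined.

(** In the opposite category, copying is a concave bifunction from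
    R^n (x) R^n to R^n and discarding one from R^0 to R^n. *)

Program Definition cv_copy n : cvbifn (n + n) n :=
  @CvBifn (n + n) n (fun (u : 'cV_(n + n)) (z : 'cV_n) =>
    - cxindic R (usubmx u = z /\ dsubmx u = z))%E _.
Next Obligation.
move=> n.
apply: (concave_bifn_of (G := cx_lin (dup_mx R n)^T)) => x y; rewrite oppeK.
congr cxindic; apply/propext; rewrite trmxK dup_mxv.
by rewrite -[x in X in _ <-> X]vsubmxK; split=> [[-> ->]//|/eq_col_mx[]].
Qed.

Program Definition cv_discard n : cvbifn 0 n :=
  @CvBifn 0 n (fun (_ : 'cV[R]_0) (_ : 'cV[R]_n) => 0%E) _.
Next Obligation.
move=> n.
apply: (concave_bifn_of (G := cx_lin (bang_mx R n)^T)) => x y.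
rewrite oppe0 /= /cxindic asboolT// trmxK.
by apply/matrixP => -[].
Qed.

Definition cv_lin m n (A : 'M[R]_(n, m)) : cvbifn n m :=
  CvBifn (concave_bifn_of (G := cx_lin A^T)
    (fun x y => oppeK (cxindic R (x = A^T^T *m y)))).

Let negE_lin m n (A : 'M[R]_(n, m)) : cx_of_cv (cv_lin A) = cx_lin A^T.
Proof. by apply: cxbifn_eq => x y /=; rewrite oppeK. Qed.

Let cv_lin_comp m n p (B : 'M[R]_(p, n)) (A : 'M[R]_(n, m)) :
  cv_comp (cv_lin A) (cv_lin B) = cv_lin (B *m A).
Proof.
by apply: cx_of_cv_inj; rewrite !(negE, negE_lin) cx_lin_comp trmx_mul.
Qed.

Let cv_lin_tens m n p q (A : 'M[R]_(n, m)) (B : 'M[R]_(q, p)) :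
  cv_tens (cv_lin A) (cv_lin B) = cv_lin (dsum_mx A B).
Proof.
by apply: cx_of_cv_inj; rewrite !(negE, negE_lin) cx_lin_tens tr_dsum_mx.
Qed.

Let cv_id_lin n : cv_id n = cv_lin (1%:M : 'M[R]_n).
Proof.
by apply: cx_of_cv_inj; rewrite !(negE, negE_lin) cx_id_lin trmx1.
Qed.

Let cv_swap_lin m n : cv_swap n m = cv_lin (swap_mx R m n).
Proof.
by apply: cx_of_cv_inj; rewrite !(negE, negE_lin) cx_swap_lin tr_swap_mx.
Qed.

Let cv_copy_lin n : cv_copy n = cv_lin (dup_mx R n).
Proof.
apply: cvbifn_eq => x y /=; congr (- cxindic _ _)%E; apply/propext.
rewrite trmxK dup_mxv.
by rewrite -[x in X in _ <-> X]vsubmxK; split=> [[-> ->]//|/eq_col_mx[]].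
Qed.

Let cv_discard_lin n : cv_discard n = cv_lin (bang_mx R n).
Proof.
apply: cvbifn_eq => x y /=; rewrite /cxindic asboolT ?oppe0//.
by apply/matrixP => -[].
Qed.

Let H a b := cvbifn b a.

Let L a b (A : 'M[R]_(b, a)) : H a b := cv_lin A.

Let cmp m n p (f : H n p) (g : H m n) : H m p := cv_comp g f.

Let tns m n p q (f : H m n) (g : H p q) : H (m + p)%N (n + q)%N := cv_tens f g.

Let Lc m n p (B : 'M[R]_(p, n)) (A : 'M[R]_(n, m)) :
  cmp (L B) (L A) = L (B *m A).
Proof. exact: cv_lin_comp. Qed.

Let Lt m n p q (A : 'M[R]_(n, m)) (B : 'M[R]_(q, p)) :
  tns (L A) (L B) = L (dsum_mx A B).
Proof. exact: cv_lin_tens. Qed.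

Definition cvBiFn_op_cdcat : cdcat.
Proof.
refine (@CDCat (smop cvBiFn_smcat) cv_copy cv_discard _ _ _ _ _ _ _ _) => /=.
- move=> n; rewrite !cv_copy_lin !cv_id_lin; exact: (lin_copy_assoc Lc Lt).
- move=> n; rewrite !cv_copy_lin !cv_discard_lin !cv_id_lin.
  exact: (lin_copy_unitl Lc Lt).
- move=> n; rewrite !cv_copy_lin !cv_discard_lin !cv_id_lin.
  exact: (lin_copy_unitr Lc Lt).
- move=> n; rewrite !cv_copy_lin !cv_swap_lin; exact: (lin_copy_comm Lc).
- move=> m n; rewrite !cv_copy_lin !cv_swap_lin !cv_id_lin.
  exact: (lin_copy_tens Lc Lt).
- move=> m n; rewrite !cv_discard_lin; exact: (lin_discard_tens Lt).
- rewrite cv_copy_lin cv_id_lin; exact: (lin_copy_unit (@L)).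
- rewrite cv_discard_lin cv_id_lin; exact: (lin_discard_unit (@L)).
Defined.

End Bifunctions.

(** * Adjoints *)

Section Adjoints.
Variable R : realType.

Lemma convex_efun_le (V : lmodType R) (h : V -> \bar R) :
  (forall (u v : V) (a b t : R), 0 < t -> t < 1 ->
    (h u <= a%:E)%E -> (h v <= b%:E)%E ->
    (h (t *: u + (1 - t) *: v)%R <= (t * a + (1 - t) * b)%:E)%E) ->
  convex_efun h.
Proof.
move=> ch; apply/convex_setW => -[u a] [v b].
by rewrite !inE /epigraph /= => ha hb k k0 k1; apply/mem_set; exact: ch.
Qed.

(** The adjoint of [F : R^m -> R^n] is
    F*(y', x') = inf_(x, y) F(x, y) + <x', x> - <y', y>. *)
Program Definition cx_adj m n (F : cxbifn R m n) : cvbifn R n m :=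
  @CvBifn R n m (fun ys xs => ereal_inf (range (fun p : 'cV[R]_m * 'cV[R]_n =>
    (F p.1 p.2 + (dot xs p.1)%:E - (dot ys p.2)%:E)%E))) _.
Next Obligation.
move=> m n F; apply: convex_efun_le => -[ys xs] [ys' xs'] a b t t0 t1 /=.
have infP (f : 'cV[R]_m * 'cV[R]_n -> \bar R) (c : R) :
    (- ereal_inf (range f) <= c%:E)%E <-> (forall p, (- f p <= c%:E)%E).
  rewrite leeNl -EFinN; split=> [cf p|cf].
    by rewrite leeNl -EFinN (le_trans cf)//; apply: ereal_inf_lbound; exists p.
  by apply: le_ereal_inf_tmp => _ [p _ <-]; rewrite EFinN -leeNl.
move=> /infP ha /infP hb; apply/infP => -[x y] /=.
move: (ha (x, y)) (hb (x, y)) => /=.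
case: (F x y) => [r||] //=; try (by move=> *; exact: leNye); rewrite -?EFinD -?EFinN ?lee_fin => hr hr'.
rewrite !dotDl !dotZl.
have ht1 : 0 <= 1 - t by rewrite subr_ge0 ltW.
have := ler_wpM2l (ltW t0) hr; have := ler_wpM2l ht1 hr'.
move: (dot _ _) (dot _ _) (dot _ _) (dot _ _) => d1 d2 d3 d4; lra.
Qed.

(** The adjoint of [G : R^n -> R^m] is
    G*(x', y') = sup_(y, x) G(y, x) + <y', y> - <x', x>. *)
Program Definition cv_adj n m (G : cvbifn R n m) : cxbifn R m n :=
  @CxBifn R m n (fun xs ys => ereal_sup (range (fun p : 'cV[R]_n * 'cV[R]_m =>
    (G p.1 p.2 + (dot ys p.1)%:E - (dot xs p.2)%:E)%E))) _.
Next Obligation.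
move=> n m G; apply: convex_efun_le => -[xs ys] [xs' ys'] a b t t0 t1 /=.
have supP (f : 'cV[R]_n * 'cV[R]_m -> \bar R) (c : R) :
    (ereal_sup (range f) <= c%:E)%E <-> (forall p, (f p <= c%:E)%E).
  split=> [cf p|cf].
    by apply: le_trans cf; apply: ereal_sup_ubound; exists p.
  by apply: ge_ereal_sup => _ [p _ <-].
move=> /supP ha /supP hb; apply/supP => -[y x] /=.
move: (ha (y, x)) (hb (y, x)) => /=.
case: (G y x) => [r||] //=; try (by move=> *; exact: leNye); rewrite -?EFinD -?EFinN ?lee_fin => hr hr'.
rewrite !dotDl !dotZl.
have ht1 : 0 <= 1 - t by rewrite subr_ge0 ltW.
have := ler_wpM2l (ltW t0) hr; have := ler_wpM2l ht1 hr'.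
move: (dot _ _) (dot _ _) (dot _ _) (dot _ _) => d1 d2 d3 d4; lra.
Qed.

End Adjoints.

(** * Log-densities and cumulant generating functions *)

Section GaussBifunctions.
Variable R : realType.

Definition ginverse n (S : 'M[R]_n) : Type := {G : 'M[R]_n | S *m G *m S = S}.

Lemma addr_indic_lt (P : Prop) (r c : R) :
  (r%:E + cxindic R P < c%:E)%E <-> P /\ r < c.
Proof.
rewrite /cxindic; case: asboolP => HP; last by split=> // -[].
by rewrite -EFinD addr0 lte_fin; split=> // -[].
Qed.

Lemma psd_quad_convex n (S : 'M[R]_n) (y y' : 'cV_n) (t : R) :
  psd S -> 0 < t -> t < 1 ->
  dot (t *: y + (1 - t) *: y') (S *m (t *: y + (1 - t) *: y')) <=
  t * dot y (S *m y) + (1 - t) * dot y' (S *m y').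
Proof.
move=> [ST S0] t0 t1.
have SC u v : dot u (S *m v) = dot v (S *m u) by rewrite dot_mulmx ST dotC.
have := S0 (y + (-1) *: y').
rewrite !mulmxDr -!scalemxAr !dotDr !dotDl !dotZr !dotZl (SC y' y).
move: (dot y _) (dot y _) (dot y' _) => p q r pqr.
have t2 : 0 <= t * (1 - t) by apply: mulr_ge0; rewrite ?subr_ge0 ltW.
have := mulr_ge0 t2 pqr; lra.
Qed.

Program Definition cgf m n (f : gauss R m n) : cxbifn R m n :=
  @CxBifn R m n (fun x y =>
    ((2^-1 * dot y (gcov f *m y) + dot (gmean f) y)%:E
     + cxindic R (x = (gmat f)^T *m y))%E) _.
Next Obligation.
move=> m n f; apply/convex_bifnP => x x' y y' a b t t0 t1.
move=> /addr_indic_lt[-> ha] /addr_indic_lt[-> hb]; apply/addr_indic_lt.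
split; first by rewrite mulmxDr -!scalemxAr.
have := psd_quad_convex y y' (gcov_psd f) t0 t1.
have ht1 : 0 < 1 - t by rewrite subr_gt0.
have := ler_wpM2l (ltW ht1) (ltW hb).
move: ha; rewrite -(ltr_pM2l t0) => ha.
rewrite dotDr !dotZr.
lra.
Qed.

(** The value is -oo unless [z] lies in the image of the covariance. *)
Program Definition logpdf m n (f : gauss R m n) (G : ginverse (gcov f)) :
    cvbifn R n m :=
  @CvBifn R n m (fun y x =>
    let z := y - (gmat f *m x + gmean f) in
    ((- (2^-1 * dot z (sval G *m z)))%:E
     - cxindic R (range (mulmx (gcov f) : 'cV[R]_n -> 'cV[R]_n) z))%E) _.
Next Obligation.
move=> m n f [G GP] /=; apply/convex_efunP => -[y x] [y' x'] a b t t0 t1 /=.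
have negE (r : R) (P : Prop) :
    (- ((- r)%:E - cxindic R P) = r%:E + cxindic R P)%E.
  rewrite /cxindic; case: asboolP => _; last by [].
  by rewrite sube0 adde0 -EFinN opprK.
rewrite !negE => /addr_indic_lt[[w _ wz] ha] /addr_indic_lt[[w' _ wz'] hb].
apply/addr_indic_lt.
have GE v : dot (gcov f *m v) (G *m (gcov f *m v)) = dot v (gcov f *m v).
  have /= [ST _] := gcov_psd f.
  by rewrite -{1}ST -dot_mulmx !mulmxA GP.
have zE : t *: y + (1 - t) *: y' -
    (gmat f *m (t *: x + (1 - t) *: x') + gmean f) =
    gcov f *m (t *: w + (1 - t) *: w').
  rewrite [in RHS]mulmxDr -!scalemxAr wz wz' mulmxDr -!scalemxAr.
  move: (gmat f *m x) (gmat f *m x') => u u'.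
  by apply/matrixP => i j; rewrite !mxE; ring.
rewrite zE; split; first by exists (t *: w + (1 - t) *: w').
rewrite GE.
have := psd_quad_convex w w' (gcov_psd f) t0 t1.
move: ha hb; rewrite -wz -wz' !GE => ha hb.
have ht1 : 0 < 1 - t by rewrite subr_gt0.
have := ler_wpM2l (ltW ht1) (ltW hb).
move: ha; rewrite -(ltr_pM2l t0) => ha.
lra.
Qed.

End GaussBifunctions.

Arguments logpdf {R m n} f G.

(* Main.v *)
Require Import Defs.
From HB Require Import structures.
From mathcomp Require Import all_boot all_order all_algebra.
From mathcomp Require Import all_classical all_reals all_analysis.
From mathcomp Require Import ring lra.

Set Implicit Arguments.
Unset Strict Implicit.
Unset Printing Implicit Defensive.

Import Order.TTheory GRing.Theory Num.Theory.

Local Open Scope classical_set_scope.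
Local Open Scope ring_scope.

(** Write [f = (A, mu, Sigma)].  The image of a symmetric matrix is the
    orthogonal complement of its kernel, so [z = y - (A x + mu)] either lies in
    the image of [Sigma], as [z = Sigma w], or is not orthogonal to the kernel
    of [Sigma].  In the first case [<z, Sigma^- z> = <w, Sigma w>] whatever the
    generalized inverse and the preimage [w] ([logpdf_image]).  Hence
    [- logpdf_f(y, x) < c] means that [y = A x + mu + Sigma w] for some [w]
    with [<w, Sigma w> / 2 < c] ([logpdf_ltP]), which removes the generalized
    inverse from all that follows.

    Equalities of bifunctions are checked by comparing strict upper bounds,
    which turns infima and extended sums into existential statements.  For
    [cgf] the intermediate point of a composite is forced to be [B^T z], with
    [B] the matrix of the second map, and functoriality is an identity of
    quadratic polynomials.  For [logpdf], let the second map have matrix [A]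
    and covariance [Sigma], and the first one covariance [T], so that the
    composite has covariance [Q = Sigma + A T A^T].  A preimage [u] under [Q]
    splits into [w = u] and [v = A^T u].  Conversely, for arbitrary [w] and [v]
    the vector [Sigma w + A T v] is some [Q u] with
    [<u, Q u> <= <w, Sigma w> + <v, T v>] ([psd_infimal_convolution]): it is
    orthogonal to the kernel of [Q], and the inequality is the nonnegativity of
    the forms [Sigma] and [T] at [u - w] and [A^T u - v].  Swap, copy and
    discard are linear maps without noise, for which both bifunctions are the
    indicator of a linear graph.

    Both adjoints are computed by completing the square.  The infimum defining
    the adjoint of [cgf_f] at [(y, x)] is that of
    [<b, Sigma b> / 2 - <b, z>] over [b]: it is attained at [b = w] if
    [z = Sigma w], and is [-oo] along a kernel direction not orthogonal to [z]
    otherwise.  In the other direction, the supremum is taken over [x] and [w];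
    the part linear in [x] forces [x' = A^T y'], and [w = y'] is then optimal. *)

(** * Positive semidefinite quadratic forms *)

Section QuadraticForms.
Variable R : realType.

Lemma dotNr n (u v : 'cV[R]_n) : dot u (- v) = - dot u v.
Proof. by rewrite -scaleN1r dotZr mulN1r. Qed.

Lemma dotNl n (u v : 'cV[R]_n) : dot (- u) v = - dot u v.
Proof. by rewrite dotC dotNr dotC. Qed.

Lemma dot0r n (u : 'cV[R]_n) : dot u 0 = 0.
Proof. by rewrite /dot mulmx0 mxE. Qed.

Lemma dot0l n (u : 'cV[R]_n) : dot 0 u = 0.
Proof. by rewrite dotC dot0r. Qed.

Lemma dot_gt0 n (u : 'cV[R]_n) : u != 0 -> 0 < dot u u.
Proof.
move=> u0; have sq i : 0 <= u i 0 * u i 0 by rewrite -expr2 sqr_ge0.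
rewrite lt_def dot_sum sumr_ge0 ?andbT => [|i _]; last exact: sq.
apply: contra u0 => /eqP /(psumr_eq0P (fun i _ => sq i)) uu0.
apply/eqP/matrixP => i j; rewrite ord1 mxE; apply/eqP.
by have /eqP := uu0 i isT; rewrite mulf_eq0 orbb.
Qed.

Lemma psd_dotC n (S : 'M[R]_n) (u v : 'cV_n) :
  psd S -> dot u (S *m v) = dot v (S *m u).
Proof. by move=> [ST _]; rewrite dot_mulmx ST dotC. Qed.

(** The nonnegativity of the form at [u - v], expanded. *)
Lemma psd_dot_sub n (S : 'M[R]_n) (u v : 'cV_n) : psd S ->
  2 * dot u (S *m v) <= dot u (S *m u) + dot v (S *m v).
Proof.
move=> Sp; have := Sp.2 (u - v).
rewrite mulmxBr !(dotDl, dotDr, dotNl, dotNr) (psd_dotC v u Sp); lra.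
Qed.

(** Otherwise the form at [t u - S u], which is affine in [t] with slope
    [- 2 <S u, S u>], would become negative for large [t]. *)
Lemma psd_isotropic n (S : 'M[R]_n) (u : 'cV_n) :
  psd S -> dot u (S *m u) = 0 -> S *m u = 0.
Proof.
move=> Sp u0; apply/eqP; apply: contraT => /dot_gt0.
set b := dot _ _ => b0; set a := dot (S *m u) (S *m (S *m u)).
(* the affine function is a - 2 t b, here at t = (a + 1) / b *)
have := psd_dot_sub (((a + 1) / b) *: u) (S *m u) Sp.
rewrite (psd_dotC _ _ Sp) -scalemxAr !dotZr !dotZl u0 -/a.
rewrite divfK ?gt_eqF//.
have := Sp.2 (S *m u); rewrite -/a; lra.
Qed.

(** A vector outside the image of a symmetric matrix is not orthogonal to its
    kernel. *)
Lemma image_or_kernel n (S : 'M[R]_n) (z : 'cV_n) : S^T = S ->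
  (exists w, z = S *m w) \/ (exists2 k : 'cV_n, S *m k = 0 & dot k z != 0).
Proof.
move=> ST; case: (boolP (z^T <= S)%MS) => [/submxP[D zD]|].
  by left; exists D^T; rewrite -[z]trmxK zD trmx_mul ST.
rewrite submxE => /rV0Pn[j zj]; right; exists (col j (cokermx S)).
  by rewrite colE mulmxA mulmx_coker mul0mx.
by rewrite dotC /dot colE mulmxA -colE mxE.
Qed.

(** The inequality behind the composition law of log-densities: [u] does at
    least as well as the pair [(w, v)] it replaces. *)
Lemma psd_infimal_convolution n p (S : 'M[R]_p) (T : 'M[R]_n)
    (A : 'M[R]_(p, n)) (w : 'cV_p) (v : 'cV_n) : psd S -> psd T ->
  let Q := S + A *m T *m A^T in
  exists2 u : 'cV_p, S *m w + A *m (T *m v) = Q *m u &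
    dot u (Q *m u) <= dot w (S *m w) + dot v (T *m v).
Proof.
move=> Sp Tp Q; have Qp : psd Q := psdD Sp (psd_conj A Tp).
have QE x y : dot x (Q *m y) = dot x (S *m y) + dot (A^T *m x) (T *m (A^T *m y)).
  by rewrite mulmxDl dotDr -!mulmxA (dot_mulmx A).
case: (image_or_kernel (S *m w + A *m (T *m v)) Qp.1) => [[u uE]|[k k0]].
  exists u => //; have := psd_dot_sub u w Sp; have := psd_dot_sub (A^T *m u) v Tp.
  have := QE u u; rewrite -{1}uE dotDr (dot_mulmx A) QE; lra.
(* a vector of the kernel of Q is isotropic for both summands *)
have /eqP := QE k k; rewrite k0 dot0r eq_sym paddr_eq0 ?(Sp.2, Tp.2)//.
move=> /andP[/eqP/(psd_isotropic Sp) Sk /eqP/(psd_isotropic Tp) Tk].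
by rewrite dotDr (psd_dotC _ _ Sp) Sk (dot_mulmx A) (psd_dotC _ _ Tp) Tk
  !dot0r addr0 eqxx.
Qed.

End QuadraticForms.

(** * Cumulant generating functions *)

Section CumulantGeneratingFunctions.
Variable R : realType.

Lemma cgf_ltP m n (f : gauss R m n) x y (c : R) :
  (cgf f x y < c%:E)%E <->
  x = (gmat f)^T *m y /\
  2^-1 * dot y (gcov f *m y) + dot (gmean f) y < c.
Proof. exact: addr_indic_lt. Qed.

Lemma cgf_lin m n (A : 'M[R]_(n, m)) : cgf (gauss_lin A) = cx_lin A.
Proof.
apply: cxbifn_eq => x y /=.
by rewrite mul0mx dot0r dot0l mulr0 addr0 add0e.
Qed.

Lemma cgf_comp m n p (g : gauss R n p) (f : gauss R m n) :
  cgf (gauss_comp g f) = cx_comp (cgf g) (cgf f).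
Proof.
have E z : 2^-1 * dot z (gcov (gauss_comp g f) *m z) +
    dot (gmean (gauss_comp g f)) z =
  (2^-1 * dot ((gmat g)^T *m z) (gcov f *m ((gmat g)^T *m z)) +
   dot (gmean f) ((gmat g)^T *m z)) +
  (2^-1 * dot z (gcov g *m z) + dot (gmean g) z).
  rewrite /= mulmxDl dotDr dotDl -!mulmxA (dot_mulmx (gmat g)).
  by rewrite (dotC (gmat g *m _)) (dot_mulmx (gmat g)) (dotC _ (gmean f)); ring.
apply: cxbifn_eq_lt => x z c; split.
- move=> /cgf_ltP[-> ltc]; apply/inf_ltP; exists ((gmat g)^T *m z).
  move: ltc; rewrite E; set a := (X in X + _ < _); set b := (X in _ + X < _).
  (* the slack c - a - b is shared equally between the two terms *)
  move=> ltc; apply/dadde_ltP; exists (a + (c - a - b) / 2), (b + (c - a - b) / 2).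
  split; last by field.
  + apply/cgf_ltP; split; first by rewrite trmx_mul mulmxA.
    by rewrite -/a; lra.
  + by apply/cgf_ltP; split=> //; rewrite -/b; lra.
- move=> /inf_ltP[y /dadde_ltP[a [b [/cgf_ltP[-> fa] /cgf_ltP[yE gb] <-]]]].
  apply/cgf_ltP; split; first by rewrite /= trmx_mul yE mulmxA.
  by rewrite E -yE ltrD.
Qed.

Lemma cgf_tens m n p q (f : gauss R m n) (g : gauss R p q) :
  cgf (gauss_tens f g) = cx_tens (cgf f) (cgf g).
Proof.
have E y : 2^-1 * dot y (gcov (gauss_tens f g) *m y) +
    dot (gmean (gauss_tens f g)) y =
  (2^-1 * dot (usubmx y) (gcov f *m usubmx y) + dot (gmean f) (usubmx y)) +
  (2^-1 * dot (dsubmx y) (gcov g *m dsubmx y) + dot (gmean g) (dsubmx y)).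
  by rewrite /= -{1 2 3}[y]vsubmxK dsum_mxv !dot_col; ring.
apply: cxbifn_eq_lt => x y c; split.
- move=> /cgf_ltP[-> ltc]; move: ltc; rewrite E [_ *m y]mul_tr_dsum.
  set a := (X in X + _ < _); set b := (X in _ + X < _) => ltc.
  apply/dadde_ltP; exists (a + (c - a - b) / 2), (b + (c - a - b) / 2).
  split; last by field.
  + by apply/cgf_ltP; rewrite col_mxKu; split=> //; rewrite -/a; lra.
  + by apply/cgf_ltP; rewrite col_mxKd; split=> //; rewrite -/b; lra.
- move=> /dadde_ltP[a [b [/cgf_ltP[xu fa] /cgf_ltP[xd gb] <-]]].
  apply/cgf_ltP; split; last by rewrite E ltrD.
  by rewrite [RHS]mul_tr_dsum -xu -xd vsubmxK.
Qed.

Lemma cgf_cd_functor : @is_cd_functor (gauss_cdcat R) (cxBiFn_cdcat R)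
  (fun m n (f : gauss R m n) => cgf f).
Proof.
split=> [n|m n p g f|m n p q f g|m n|n|n].
- by rewrite [LHS]cgf_lin -cx_id_lin.
- exact: cgf_comp.
- exact: cgf_tens.
- by rewrite [LHS]cgf_lin -cx_swap_lin.
- by rewrite [LHS]cgf_lin -cx_copy_lin.
- by rewrite [LHS]cgf_lin -cx_discard_lin.
Qed.

End CumulantGeneratingFunctions.

(** * Log-densities *)

Section LogDensities.
Variable R : realType.

Lemma cvbifn_eq_lt m n (F G : cvbifn R m n) :
  (forall x y (c : R), (- F x y < c%:E)%E <-> (- G x y < c%:E)%E) -> F = G.
Proof.
by move=> FG; apply: cvbifn_eq => x y; apply/oppe_inj/eqe_lt.
Qed.

(** Neither the generalized inverse nor the choice of the preimage [w] of the
    centred point matters. *)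
Lemma logpdf_image m n (f : gauss R m n) (G : ginverse (gcov f)) x w :
  logpdf f G (gmat f *m x + gmean f + gcov f *m w) x =
  (- (2^-1 * dot w (gcov f *m w)))%:E.
Proof.
case: G => G GP /=.
have -> (a b : 'cV[R]_n) : a + b - a = b by rewrite addrC addKr.
rewrite /cxindic asboolT; last by exists w.
rewrite oppe0 adde0; congr (- (_ * _))%:E.
by rewrite -{1}(gcov_psd f).1 -dot_mulmx !mulmxA GP.
Qed.

Lemma logpdf_notin m n (f : gauss R m n) (G : ginverse (gcov f)) y x :
  ~ (exists w, y - (gmat f *m x + gmean f) = gcov f *m w) ->
  logpdf f G y x = -oo%E.
Proof.
move=> zN /=; rewrite /cxindic asboolF//.
by move=> [w _ wz]; apply: zN; exists w.
Qed.

Lemma logpdf_ltP m n (f : gauss R m n) (G : ginverse (gcov f)) y x (c : R) :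
  (- logpdf f G y x < c%:E)%E <->
  exists2 w, y = gmat f *m x + gmean f + gcov f *m w &
    2^-1 * dot w (gcov f *m w) < c.
Proof.
split=> [|[w -> wc]]; last by rewrite logpdf_image -EFinN opprK lte_fin.
have [[w wE]|zN] :=
    pselect (exists w, y - (gmat f *m x + gmean f) = gcov f *m w).
  have -> : y = gmat f *m x + gmean f + gcov f *m w by rewrite -wE addrC subrK.
  by rewrite logpdf_image -EFinN opprK lte_fin; exists w.
by rewrite logpdf_notin.
Qed.

Lemma logpdf_linE m n (A : 'M[R]_(n, m))
    (G : ginverse (gcov (gauss_lin A))) y x :
  logpdf (gauss_lin A) G y x = (- cxindic R (y = A *m x))%E.
Proof.
apply/oppe_inj/eqe_lt => c; rewrite oppeK; split.
  move=> /logpdf_ltP[w /= ->]; rewrite mul0mx dot0r mulr0 !addr0 => c0.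
  exact/cxindic_ltP.
move=> /cxindic_ltP[-> c0]; apply/logpdf_ltP.
by exists 0 => /=; rewrite mul0mx ?dot0r ?mulr0 ?addr0.
Qed.

Lemma logpdf_comp m n p (g : gauss R n p) (f : gauss R m n)
    (Ggf : ginverse (gcov (gauss_comp g f))) (Gg : ginverse (gcov g))
    (Gf : ginverse (gcov f)) :
  logpdf (gauss_comp g f) Ggf = cv_comp (logpdf f Gf) (logpdf g Gg).
Proof.
have sumE (a b c d e : 'cV[R]_p) : a + (b + c) + (d + e) = a + c + e + b + d.
  by apply/matrixP => i j; rewrite !mxE; ring.
apply: cvbifn_eq_lt => z x c; rewrite [cv_fun (cv_comp _ _) _ _]/=.
rewrite oppe_sup_daddE; split.
- move=> /logpdf_ltP[u zE]; rewrite [gcov _]/= => ltc.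
  apply/inf_ltP.
  exists (gmat f *m x + gmean f + gcov f *m ((gmat g)^T *m u)).
  move: ltc; rewrite mulmxDl -!mulmxA dotDr (dot_mulmx (gmat g)) mulrDr.
  set b := (X in X + _ < _); set a := (X in _ + X < _) => ltc.
  apply/dadde_ltP; exists (b + (c - a - b) / 2), (a + (c - a - b) / 2).
  split; last by field.
  + apply/logpdf_ltP; exists u; last by rewrite -/b; lra.
    rewrite zE /= mulmxDl !mulmxDr -!mulmxA.
    exact: sumE.
  + by apply/logpdf_ltP; exists ((gmat g)^T *m u) => //; rewrite -/a; lra.
- move=> /inf_ltP[y /dadde_ltP[b [a [/logpdf_ltP[w zE gb] /logpdf_ltP[v yE fa] <-]]]].
  have [u uE ule] := psd_infimal_convolution (gmat g) w v (gcov_psd g) (gcov_psd f).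
  apply/logpdf_ltP; exists u; last by rewrite /=; lra.
  by rewrite /= -uE zE yE !mulmxDr -!mulmxA sumE.
Qed.

Lemma logpdf_tens m n p q (f : gauss R m n) (g : gauss R p q)
    (Gfg : ginverse (gcov (gauss_tens f g))) (Gf : ginverse (gcov f))
    (Gg : ginverse (gcov g)) :
  logpdf (gauss_tens f g) Gfg = cv_tens (logpdf f Gf) (logpdf g Gg).
Proof.
apply: cvbifn_eq_lt => y x c.
rewrite [(- cv_tens _ _ _ _)%E]oppe_daddeE -[x]vsubmxK !(col_mxKu, col_mxKd).
set xu := usubmx x; set xd := dsubmx x; split.
- move=> /logpdf_ltP[w]; rewrite -[w]vsubmxK /= !dsum_mxv !add_col_mx dot_col.
  rewrite mulrDr; set a := (X in X + _ < _); set b := (X in _ + X < _).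
  move=> -> ltc; rewrite !(col_mxKu, col_mxKd).
  apply/dadde_ltP; exists (a + (c - a - b) / 2), (b + (c - a - b) / 2).
  split; last by field.
  + by apply/logpdf_ltP; exists (usubmx w) => //; rewrite -/a; lra.
  + by apply/logpdf_ltP; exists (dsubmx w) => //; rewrite -/b; lra.
- move=> /dadde_ltP[a [b [/logpdf_ltP[w yu fa] /logpdf_ltP[v yd gb] <-]]].
  apply/logpdf_ltP; exists (col_mx w v) => /=.
    by rewrite !dsum_mxv !add_col_mx -yu -yd vsubmxK.
  by rewrite dsum_mxv dot_col mulrDr ltrD.
Qed.

Lemma logpdf_cd_functor
    (ginv : forall m n (f : gauss R m n), ginverse (gcov f)) :
  @is_cd_functor (gauss_cdcat R) (cvBiFn_op_cdcat R)
    (fun m n (f : gauss R m n) => logpdf f (ginv m n f)).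
Proof.
split=> [n|m n p g f|m n p q f g|m n|n|n].
- by apply: cvbifn_eq => y x; rewrite [LHS]logpdf_linE mul1mx.
- exact: logpdf_comp.
- exact: logpdf_tens.
- apply: cvbifn_eq => y x; rewrite [LHS]logpdf_linE /=.
  congr (- cxindic _ _)%E; apply/propext.
  rewrite -[in X in X <-> _](vsubmxK x) swap_mxv.
  rewrite -[in X in X <-> _](vsubmxK y).
  by split=> [/eq_col_mx[]|[-> ->]].
- apply: cvbifn_eq => y x; rewrite [LHS]logpdf_linE /=.
  congr (- cxindic _ _)%E; apply/propext; rewrite dup_mxv.
  rewrite -[in X in X <-> _](vsubmxK y).
  by split=> [/eq_col_mx[]|[-> ->]].
- apply: cvbifn_eq => y x; rewrite [LHS]logpdf_linE /cxindic asboolT ?oppe0//.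
  by apply/matrixP => -[].
Qed.

End LogDensities.

(** * Duality *)

Section Duality.
Variable R : realType.

Lemma cx_adj_cgf m n (f : gauss R m n) (G : ginverse (gcov f)) :
  cx_adj (cgf f) = logpdf f G.
Proof.
have Sp := gcov_psd f.
apply: cvbifn_eq => y x.
pose h (p : 'cV_m * 'cV_n) :=
  (cgf f p.1 p.2 + (dot x p.1)%:E - (dot y p.2)%:E)%E.
rewrite -[LHS]/(ereal_inf (range h)).
pose z := y - (gmat f *m x + gmean f).
have hE b : h ((gmat f)^T *m b, b) =
    (2^-1 * dot b (gcov f *m b) - dot b z)%:E.
  rewrite /h /= /cxindic asboolT// adde0 -!(EFinD, EFinB); congr _%:E.
  rewrite (dotC x) -dot_mulmx /z !(dotDr, dotNr) (dotC y) (dotC (gmean f)).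
  by ring.
have [[w wz]|[k Sk kz]] := image_or_kernel z Sp.1.
- have yE : y = gmat f *m x + gmean f + gcov f *m w.
    by rewrite -wz addrC subrK.
  rewrite [in RHS]yE logpdf_image; apply/eqP; rewrite eq_le; apply/andP; split.
    apply: ereal_inf_lbound; exists ((gmat f)^T *m w, w) => //.
    by rewrite hE wz; congr _%:E; field.
  apply: le_ereal_inf_tmp => _ [[a b] _ <-].
  have [->|/eqP ab] := eqVneq a ((gmat f)^T *m b).
    rewrite hE lee_fin wz; have := psd_dot_sub b w Sp; lra.
  by rewrite /h /= /cxindic asboolF//= leey.
- rewrite logpdf_notin; last first.
    move=> [w wz]; move: kz; rewrite /z wz.
    by rewrite (psd_dotC _ _ Sp) Sk dot0r eqxx.
  apply/eqe_lt => c; rewrite ltNyr; split=> // _; apply/(inf_ltP h).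
  (* the quadratic part vanishes along k, and <b, z> = 1 - c *)
  pose b := ((1 - c) / dot k z) *: k; exists ((gmat f)^T *m b, b).
  rewrite hE -scalemxAr Sk scaler0 dot0r mulr0 sub0r dotZl divfK//.
  by rewrite lte_fin; lra.
Qed.

Lemma cv_adj_logpdf m n (f : gauss R m n) (G : ginverse (gcov f)) :
  cv_adj (logpdf f G) = cgf f.
Proof.
have Sp := gcov_psd f.
apply: cxbifn_eq => xs ys.
pose h (p : 'cV_n * 'cV_m) :=
  (logpdf f G p.1 p.2 + (dot ys p.1)%:E - (dot xs p.2)%:E)%E.
rewrite -[LHS]/(ereal_sup (range h)).
have hE x w : h (gmat f *m x + gmean f + gcov f *m w, x) =
    (dot ys (gcov f *m w) - 2^-1 * dot w (gcov f *m w) + dot (gmean f) ys +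
     dot ((gmat f)^T *m ys - xs) x)%:E.
  rewrite /h logpdf_image -!(EFinD, EFinB); congr _%:E.
  rewrite !(dotDr, dotDl, dotNl) (dot_mulmx (gmat f)) (dotC ys (gmean f)).
  by ring.
have [xsE|/eqP xsN] := eqVneq xs ((gmat f)^T *m ys).
- rewrite /= /cxindic asboolT// adde0; apply/eqP; rewrite eq_le; apply/andP.
  split; last first.
    apply: ereal_sup_ubound.
    exists (gmat f *m 0 + gmean f + gcov f *m ys, 0) => //.
    by rewrite hE dot0r; congr _%:E; field.
  apply: ge_ereal_sup => _ [[y x] _ <-].
  have [[w wE]|zN] :=
      pselect (exists w, y - (gmat f *m x + gmean f) = gcov f *m w).
    have -> : y = gmat f *m x + gmean f + gcov f *m w.
      by rewrite -wE addrC subrK.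
    rewrite hE -xsE subrr dot0l lee_fin; have := psd_dot_sub ys w Sp; lra.
  by rewrite /h logpdf_notin//= leNye.
- rewrite /= /cxindic asboolF// addey//.
  pose d := (gmat f)^T *m ys - xs.
  have d0 : 0 < dot d d.
    by apply: dot_gt0; rewrite subr_eq0 eq_sym; apply/eqP.
  apply/eqyP => c _.
  (* with w = 0, the value at this multiple of d is exactly c *)
  pose x := ((c - dot (gmean f) ys) / dot d d) *: d.
  apply: ereal_sup_ubound.
  exists (gmat f *m x + gmean f + gcov f *m 0, x) => //.
  rewrite hE -/d mulmx0 !dot0r mulr0 subr0 add0r dotZr divfK ?gt_eqF//.
  by rewrite addrC subrK.
Qed.

End Duality.

Theorem theorem5 (R : realType)
    (ginv : forall (m n : nat) (f : gauss R m n), ginverse (gcov f)) :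
  [/\ @is_cd_functor (gauss_cdcat R) (cvBiFn_op_cdcat R)
        (fun (m n : nat) (f : gauss R m n) => logpdf f (ginv m n f)),
      @is_cd_functor (gauss_cdcat R) (cxBiFn_cdcat R)
        (fun (m n : nat) (f : gauss R m n) => cgf f),
      (forall (m n : nat) (f : gauss R m n),
        cx_adj (cgf f) = logpdf f (ginv m n f))
    & (forall (m n : nat) (f : gauss R m n),
        cv_adj (logpdf f (ginv m n f)) = cgf f)].
Proof.
split.
- exact: logpdf_cd_functor.
- exact: cgf_cd_functor.
- by move=> m n f; exact: cx_adj_cgf.
- by move=> m n f; exact: cv_adj_logpdf.
Qed.
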